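(* Let $u\in H(\mathbb D)$ and $\varphi\in S(\mathbb D)$. Then \[ \|uC_\varphi\|_{\mathcal B\to\mathcal B}\approx |u(0)|\log\frac{2}{1-|\varphi(0)|^2}+\sup_{a\in\mathbb D}\alpha(u,\varphi,a)+\sup_{a\in\mathbb D}\beta(u,\varphi,a), \] where \[ \alpha(u,\varphi,a)=|u(a)|\,\|\sigma_{\varphi(a)}\circ\varphi\circ\sigma_a\|_{A^2},\qquad \beta(u,\varphi,a)=\log\frac{2}{1-|\varphi(a)|^2}\,\|u\circ\sigma_a-u(a)\|_{A^2}. \]
   Context: $\mathbb D$ is the open unit disk, $H(\mathbb D)$ the analytic functions on $\mathbb D$, and $S(\mathbb D)$ the set of analytic self-maps of $\mathbb D$. For $a\in\mathbb D$, $\sigma_a(z)=\frac{a-z}{1-\bar a z}$. $dA=\frac1\pi\,dx\,dy$ is normalized area measure on $\mathbb D$, and $\|f\|_{A^p}=(\int_{\mathbb D}|f|^p\,dA)^{1/p}$. The Bloch space $\mathcal B$ consists of $f\in H(\mathbb D)$ with $\|f\|_\beta=\sup_{z\in\mathbb D}(1-|z|^2)|f'(z)|<\infty$, normed by $\|f\|_{\mathcal B}=|f(0)|+\|f\|_\beta$. The weighted composition operator is $(uC_\varphi f)(z)=u(z)f(\varphi(z))$, and $\|uC_\varphi\|_{\mathcal B\to\mathcal B}$ is its operator norm on $\mathcal B$ (possibly $+\infty$). The notation $X\approx Y$ means there are positive constants $c,C$ independent of $u$ and $\varphi$ with $cY\le X\le CY$ (so in particular one side is finite iff the other is). *)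

(* Defs.v *)
From HB Require Import structures.
From mathcomp Require Import all_boot all_order all_algebra.
From mathcomp Require Import all_classical all_reals all_analysis.
From mathcomp Require Import complex.
Set Implicit Arguments. Unset Strict Implicit. Unset Printing Implicit Defensive.
Import Order.TTheory GRing.Theory Num.Theory.
Import numFieldNormedType.Exports.
Local Open Scope classical_set_scope.
Local Open Scope ring_scope.
Local Open Scope complex_scope.

Section Defs.
Variable R : realType.
Local Notation C := R[i].

Definition cmod (z : C) : R := Num.sqrt (complex.Re z ^+ 2 + complex.Im z ^+ 2).
Definition disk : set C := [set z | cmod z < 1].
Definition holo (f : C -> C) : Prop := forall z, disk z -> derivable (f : C^o -> C^o) z 1.
Definition dd (f : C -> C) (z : C) : C := derive1 (f : C^o -> C^o) z.

Definition selfmap (phi : C -> C) : Prop :=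
  holo phi /\ forall z, disk z -> disk (phi z).

Definition sigma (a z : C) : C := (a - z) / (1 - a^* * z).

Definition bloch_semi (f : C -> C) : \bar R :=
  ereal_sup [set ((1 - cmod z ^+ 2) * cmod (dd f z))%:E | z in disk].
Definition bloch_norm (f : C -> C) : \bar R :=
  ((cmod (f 0))%:E + bloch_semi f)%E.

Definition wcomp (u phi f : C -> C) : C -> C := fun z => u z * f (phi z).
Definition opnorm (u phi : C -> C) : \bar R :=
  ereal_sup [set bloch_norm (wcomp u phi f) |
             f in [set f | holo f /\ (bloch_norm f <= 1)%E]].

(** the unit disk as a subset of R x R, and the A^2 norm w.r.t.
    normalized area measure dA = (1/pi) dx dy *)
Definition disk2 : set (R * R) := [set p | p.1 ^+ 2 + p.2 ^+ 2 < 1].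
Definition A2norm (f : C -> C) : \bar R :=
  (((pi^-1)%:E *
    \int[(@lebesgue_measure R \x @lebesgue_measure R)%E]_(p in disk2)
        ((cmod (f (p.1 +i* p.2)) ^+ 2)%:E)) `^ (2^-1))%E.

Definition logterm (w : C) : R := ln (2 / (1 - cmod w ^+ 2)).

Definition alpha (u phi : C -> C) (a : C) : \bar R :=
  ((cmod (u a))%:E * A2norm (fun z => sigma (phi a) (phi (sigma a z))))%E.
Definition beta (u phi : C -> C) (a : C) : \bar R :=
  ((logterm (phi a))%:E * A2norm (fun z => (u (sigma a z) - u a)%R))%E.

Definition rhs (u phi : C -> C) : \bar R :=
  ((cmod (u 0) * logterm (phi 0))%:E
   + ereal_sup (alpha u phi @` disk) + ereal_sup (beta u phi @` disk))%E.
End Defs.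

(* Main.v *)
(* The key estimate is |h'(0)| <= C ||h||_{A^2} for holomorphic h with h(0) = 0:
   by Goursat's theorem the integral of h / z^2 over the boundary of every box
   around 0 is the same, small boxes show that it is of the size of h'(0), and
   averaging over boxes bounds it by ||h||_{A^2}. Applied to u o sigma_a - u(a)
   and to sigma_{phi(a)} o phi o sigma_a it bounds the two terms of (u f o phi)'
   by beta and alpha (the logarithm being the growth of a Bloch function), whence
   the upper bound; applied to self-maps of the disk it gives a non-sharp
   Schwarz-Pick inequality. For the lower bound, let N be the operator norm. The
   images of 1 and sigma_{phi(a)} under u C_phi have Bloch seminorm at most 2 N, and
   partial sums of log (1 / (1 - conj(phi(a)) z)) as test functions give
   (1 - |a|^2) |u'(a)| log (2 / (1 - |phi(a)|^2)) <= 14 N. Integrating these bounds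
   along radii, after composition with sigma_a, dominates the functions whose A^2
   norms define alpha and beta by powers of 1 + log (1 / (1 - |z|)), which belong to
   A^2; Schwarz-Pick compares the logarithms at a and at sigma_a(z). *)
Require Import Defs.
From HB Require Import structures.
From mathcomp Require Import all_boot all_order all_algebra.
From mathcomp Require Import all_classical all_reals all_analysis.
From mathcomp Require Import measurable_realfun complex ring lra.
Set Implicit Arguments.
Unset Strict Implicit.
Unset Printing Implicit Defensive.
Import Order.TTheory GRing.Theory Num.Theory.
Import numFieldNormedType.Exports.
Local Open Scope classical_set_scope.
Local Open Scope ring_scope.

(** * Line integrals and Goursat's theorem on boxes *)

Section Goursat.
Variable R : realType.
Notation mu := (@lebesgue_measure R).
Implicit Types (f g : R -> R) (p q : R -> R -> R) (a b c d x y e k : R).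

(** [holo] asserts differentiability only, with no continuity of the derivative, so the one fact of
    Cauchy type that is needed comes from bisection. Boxes with sides parallel to the axes are the
    right contours: their sides are one-variable integrals, and families of parallel sides fit
    Tonelli's theorem for the product measure. As only comparability is claimed, constants may be
    crude: a lower bound on the four sides of a small square replaces a residue, and the weight 1 /
    sqrt (1 - x^2 - y^2), whose sections integrate to arcsine differences, replaces polar
    coordinates. The obstacle in the lower bound is [beta]: its logarithm is taken at [phi a],
    whereas the bound on the derivative of [u] at [sigma a z] carries the logarithm at
    [phi (sigma a z)]. Exchanging them costs a factor [1 + K * hlog z], which integrates along the
    radius to a multiple of [hlog z ^+ 2]. Hence the area norm must be controlled for functions of
    size [(1 + hlog z) ^+ 2], that is, the fourth power of a logarithm must be integrable. *)

Definition segint f a b : R := \int[mu]_(x in `[a, b]) f x.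

Lemma integrable_segment f a b : {within `[a, b], continuous f} ->
  mu.-integrable `[a, b] (EFin \o f).
Proof. by apply: continuous_compact_integrable; exact: segment_compact. Qed.

Lemma segint_cst k a b : a <= b -> segint (cst k) a b = k * (b - a).
Proof.
move=> ab; rewrite /segint Rintegral_cst//= lebesgue_measure_itv/= lte_fin.
by case: ltgtP ab => //= -> _; rewrite subrr.
Qed.

Lemma segint_le f g a b : {within `[a, b], continuous f} ->
  {within `[a, b], continuous g} ->
  (forall x, a <= x <= b -> f x <= g x) -> segint f a b <= segint g a b.
Proof.
move=> cf cg fg; apply: le_Rintegral => //.
- exact: integrable_segment.
- exact: integrable_segment.

Qed.

Lemma segint_chasles f a m b : a <= m <= b -> {within `[a, b], continuous f} ->
  segint f a b = segint f a m + segint f m b.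
Proof.
move=> /andP[am mb] cf; apply/eqP; rewrite addrC -subr_eq /segint.
rewrite Rintegral_itvB ?bnd_simp//; last exact: integrable_segment.
rewrite Rintegral_itv_obnd_cbnd//.
have := integrable_segment cf; apply: integrableS => //.
by apply: subset_itvr; rewrite bnd_simp.
Qed.

Lemma segint_near_cst f g k e a b : a <= b -> {within `[a, b], continuous f} ->
  {within `[a, b], continuous g} ->
  (forall x, a <= x <= b -> `|f x - g x - k| <= e) ->
  `|segint f a b - segint g a b - k * (b - a)| <= e * (b - a).
Proof.
move=> ab cf cg fgk.
have cfg : {within `[a, b], continuous (fun x => f x - g x)}.
  by move=> x; apply: cvgB; [exact: cf|exact: cg].
have -> : segint f a b - segint g a b = segint (fun x => f x - g x) a b.
  by rewrite /segint RintegralB//; exact: integrable_segment.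
have ccst (z : R) : {within `[a, b], continuous (cst z : R -> R)}.
  by apply: continuous_subspaceT => x; exact: cst_continuous.
have /= := segint_le cfg (ccst (k + e)) _; have /= := segint_le (ccst (k - e)) cfg _.
rewrite !segint_cst// => H1 H2.
have {}H1 := H1 _; have {}H2 := H2 _.
have : (k - e) * (b - a) <= segint (fun x => f x - g x) a b.
  by apply: H1 => x /fgk /=; rewrite ler_norml => /andP[]; lra.
have : segint (fun x => f x - g x) a b <= (k + e) * (b - a).
  by apply: H2 => x /fgk /=; rewrite ler_norml => /andP[]; lra.
by rewrite ler_norml => ? ?; apply/andP; split; lra.
Qed.

Lemma segint_norm_le f g a b : {within `[a, b], continuous f} ->
  {within `[a, b], continuous g} ->
  (forall x, a <= x <= b -> `|f x| <= g x) -> `|segint f a b| <= segint g a b.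
Proof.
move=> cf cg fg; apply: (@le_trans _ _ (segint (fun x => `|f x|) a b)).
  by apply: le_normr_Rintegral => //; exact: integrable_segment.
by apply: segint_le => // x; apply: cvg_norm; exact: cf.
Qed.

Lemma segint_affine f k c a b : a <= b -> {within `[a, b], continuous f} ->
  segint (fun x => k * f x + c) a b = k * segint f a b + c * (b - a).
Proof.
move=> ab cf; have cc : {within `[a, b], continuous (cst c : R -> R)}.
  by apply: continuous_subspaceT => x; exact: cst_continuous.
rewrite -segint_cst// /segint RintegralD//; last 2 first.
- apply: (@integrable_segment (fun x => k * f x)).
  by move=> x; apply: cvgM; [exact: cvg_cst|exact: cf].
- exact: integrable_segment.
by rewrite RintegralZl//; exact: integrable_segment.
Qed.

Lemma segint_subitv f a b a' b' : a <= a' -> a' <= b' -> b' <= b ->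
  {within `[a, b], continuous f} -> (forall x, a <= x <= b -> 0 <= f x) ->
  segint f a' b' <= segint f a b.
Proof.
move=> aa ab bb cf f0.
have f0' c d : a <= c -> d <= b -> 0 <= segint f c d.
  move=> ac db; apply: Rintegral_ge0 => x /=; rewrite in_itv/= => ?.
  by apply: f0; lra.
have cf' : {within `[a, b'], continuous f}.
  by apply: continuous_subspaceW cf; apply: subset_itvl; rewrite bnd_simp.
rewrite (@segint_chasles f a b' b)//; last by lra.
rewrite (@segint_chasles f a a' b')//; last by lra.
have := f0' a a'; have := f0' b' b; lra.
Qed.

(* The 1-form [p dx + q dy] is differentiable at [(x0, y0)], with zero exterior
   derivative there: [b] is both dp/dy and dq/dx. *)
Definition closed_at p q x0 y0 := exists a b c, forall e, 0 < e ->
  exists2 d, 0 < d & forall x y, `|x - x0| < d -> `|y - y0| < d ->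
    `|p x y - p x0 y0 - (a * (x - x0) + b * (y - y0))|
      <= e * (`|x - x0| + `|y - y0|) /\
    `|q x y - q x0 y0 - (b * (x - x0) + c * (y - y0))|
      <= e * (`|x - x0| + `|y - y0|).

Lemma lin_continuous f x0 a : (exists2 d, 0 < d &
    forall x, `|x - x0| < d -> `|f x - f x0 - a * (x - x0)| <= `|x - x0|) ->
  {for x0, continuous f}.
Proof.
move=> [d d0 H]; apply/cvgrPdist_lt => e e0.
have n0 : 0 < 1 + `|a| by rewrite ltr_pwDl.
apply/nbhs_ballP; exists (Num.min d (e / (1 + `|a|))) => /=.
  by rewrite lt_min d0 divr_gt0.
move=> x; rewrite /ball/= distrC lt_min => /andP[/H{}H xe].
rewrite ltr_pdivlMr// in xe.
rewrite distrC -[_ - _](subrK (a * (x - x0))) (le_lt_trans (ler_normD _ _))//.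
apply: le_lt_trans xe; rewrite [leRHS]mulrDr mulr1 lerD ?H//.
by rewrite normrM mulrC.
Qed.

Lemma closed_at_continuous p q x0 y0 : closed_at p q x0 y0 ->
  {for x0, continuous (p ^~ y0)} /\ {for y0, continuous (q x0)}.
Proof.
move=> [a [b [c /(_ 1 ltr01)[d d0 H]]]]; split.
- apply: (@lin_continuous _ _ a); exists d => // x xd.
  have := H x y0 xd; rewrite !subrr normr0 !mulr0 !addr0 mul1r.
  by move=> /(_ d0)[].
- apply: (@lin_continuous _ _ c); exists d => // y yd.
  have /(_ _ yd) := H x0 y; rewrite !subrr normr0 !mulr0 !add0r mul1r.
  by move=> /(_ d0)[].
Qed.

(** The counterclockwise integral of [p dx + q dy] over the boundary of [[a, b]] x [[c, d]]. *)
Definition circulation p q a b c d : R :=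
  segint (p ^~ c) a b - segint (p ^~ d) a b + segint (q b) c d - segint (q a) c d.

Section rectangle.
Variables (p q : R -> R -> R) (a b c d : R).
Hypothesis pq : forall x y, a <= x <= b -> c <= y <= d -> closed_at p q x y.

Lemma closed_continuousp y a' b' : a <= a' -> b' <= b -> c <= y <= d ->
  {within `[a', b'], continuous (p ^~ y)}.
Proof.
move=> aa bb cyd; apply: continuous_in_subspaceT => x; rewrite inE/= in_itv/= => xab.
by apply: (closed_at_continuous _).1; apply: pq => //; lra.
Qed.

Lemma closed_continuousq x c' d' : c <= c' -> d' <= d -> a <= x <= b ->
  {within `[c', d'], continuous (q x)}.
Proof.
move=> aa bb cyd; apply: continuous_in_subspaceT => y; rewrite inE/= in_itv/= => xab.
by apply: (closed_at_continuous _).2; apply: pq => //; lra.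
Qed.

Lemma circulation_split_x a' m b' c' d' : a <= a' -> a' <= m <= b' -> b' <= b ->
  c <= c' -> c' <= d' -> d' <= d ->
  circulation p q a' b' c' d' =
  circulation p q a' m c' d' + circulation p q m b' c' d'.
Proof.
move=> ? ? ? ? ? ?; rewrite /circulation.
rewrite (@segint_chasles (p ^~ c') a' m b')//; last by apply: closed_continuousp => //; lra.
rewrite (@segint_chasles (p ^~ d') a' m b')//; last by apply: closed_continuousp => //; lra.
lra.
Qed.

Lemma circulation_split_y a' b' c' m d' : c <= c' -> c' <= m <= d' -> d' <= d ->
  a <= a' -> a' <= b' -> b' <= b ->
  circulation p q a' b' c' d' =
  circulation p q a' b' c' m + circulation p q a' b' m d'.
Proof.
move=> ? ? ? ? ? ?; rewrite /circulation.
rewrite (@segint_chasles (q a') c' m d')//; last by apply: closed_continuousq => //; lra.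
rewrite (@segint_chasles (q b') c' m d')//; last by apply: closed_continuousq => //; lra.
lra.
Qed.

(** Opposite sides are paired. The affine part of the form at [(x0, y0)] contributes [be] times the
    area twice with opposite signs, since [be] is both dp/dy and dq/dx. What remains is an error
    [e * S], with [S] the half-perimeter, integrated over one side of each pair, of total length
    [S]. *)
Lemma circulation_small x0 y0 e : a <= x0 <= b -> c <= y0 <= d -> 0 < e ->
  exists2 r, 0 < r & forall a' b' c' d',
    a <= a' -> a' <= x0 <= b' -> b' <= b -> c <= c' -> c' <= y0 <= d' -> d' <= d ->
    (b' - a') + (d' - c') < r ->
    `|circulation p q a' b' c' d'| <= e * ((b' - a') + (d' - c')) ^+ 2.
Proof.
move=> x0ab y0cd e0; have [al [be [ga H]]] := pq x0ab y0cd.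
have [r r0 {}H] := H _ (divr_gt0 e0 (ltr0Sn R 1)).
exists r => // a' b' c' d' aa ax bb cc cy dd sr.
set S := b' - a' + _ in sr *.
have far x y : a' <= x <= b' -> c' <= y <= d' ->
    [/\ `|x - x0| < r, `|y - y0| < r & `|x - x0| + `|y - y0| <= S].
  move=> xab yab.
  have : `|x - x0| <= b' - a' by rewrite ler_norml; apply/andP; split; lra.
  have : `|y - y0| <= d' - c' by rewrite ler_norml; apply/andP; split; lra.
  by rewrite /S in sr *; split; lra.
have e2 : 0 <= e / 2 by lra.
have e22 : e / 2 * S + e / 2 * S = e * S by field.
have hp x : a' <= x <= b' -> `|p x c' - p x d' - be * (c' - d')| <= e * S.
  move=> xab; have [x1 y1 s1] := far x c' xab ltac:(lra).
  have [x2 y2 s2] := far x d' xab ltac:(lra).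
  have [h1 _] := H _ _ x1 y1; have [h2 _] := H _ _ x2 y2.
  have := lerD (le_trans h1 (ler_wpM2l e2 s1)) (le_trans h2 (ler_wpM2l e2 s2)).
  rewrite e22; apply: le_trans; apply: le_trans (ler_normB _ _).
  by rewrite le_eqVlt; apply/orP; left; apply/eqP; congr `|_|; ring.
have hq y : c' <= y <= d' -> `|q b' y - q a' y - be * (b' - a')| <= e * S.
  move=> yab; have [x1 y1 s1] := far b' y ltac:(lra) yab.
  have [x2 y2 s2] := far a' y ltac:(lra) yab.
  have [_ h1] := H _ _ x1 y1; have [_ h2] := H _ _ x2 y2.
  have := lerD (le_trans h1 (ler_wpM2l e2 s1)) (le_trans h2 (ler_wpM2l e2 s2)).
  rewrite e22; apply: le_trans; apply: le_trans (ler_normB _ _).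
  by rewrite le_eqVlt; apply/orP; left; apply/eqP; congr `|_|; ring.
have [ab' cd'] : a' <= b' /\ c' <= d' by split; lra.
have [ca' cb'] : a <= a' <= b /\ a <= b' <= b by split; lra.
have [cc' cd''] : c <= c' <= d /\ c <= d' <= d by split; lra.
have := segint_near_cst ab' (closed_continuousp aa bb cc') (closed_continuousp aa bb cd'') hp.
have := segint_near_cst cd' (closed_continuousq cc dd cb') (closed_continuousq cc dd ca') hq.
rewrite /circulation.
move: (segint _ _ _) => s1; move: (segint _ _ _) => s2.
move: (segint _ _ _) => s3; move: (segint _ _ _) => s4.
have -> : e * S ^+ 2 = e * S * (b' - a') + e * S * (d' - c') by rewrite /S; ring.
move: (e * S * (b' - a')) (e * S * (d' - c')) => t1 t2.
have -> : be * (c' - d') * (b' - a') = - (be * (b' - a') * (d' - c')) by ring.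
move: (be * (b' - a') * (d' - c')) => t3; clear.
rewrite !ler_norml => /andP[? ?] /andP[? ?]; apply/andP; split; lra.
Qed.

End rectangle.

Lemma nested_intervals (u v : nat -> R) : (forall n, u n <= u n.+1) ->
  (forall n, v n.+1 <= v n) -> (forall n, u n <= v n) ->
  exists x, forall n, u n <= x <= v n.
Proof.
move=> iu dv uv.
have mu' : {homo u : m n / (m <= n)%N >-> m <= n} by apply/nondecreasing_seqP.
have mv : {homo v : m n / (n <= m)%N >-> m <= n} by move=> m n mn; apply: (@nonincreasing_seqP _ _ v).1.
have ub n : ubound (range u) (v n).
  move=> _ [m _ <-]; have [mn|/ltnW nm] := leqP m n.
    exact: le_trans (mu' _ _ mn) (uv n).
  exact: le_trans (uv m) (mv _ _ nm).
have hs : has_sup (range u).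
  by split; [exists (u 0), 0|exists (v 0)].
exists (sup (range u)) => n; apply/andP; split.
  by apply: sup_upper_bound => //; exists n.
by apply: ge_sup => //; case: hs.
Qed.

(** Some quarter of a box keeps at least a quarter of its circulation, whereas at the common point
    of the nested boxes [circulation_small] makes the circulation an arbitrarily small multiple of
    [4 ^- n]. *)
Theorem goursat p q a b c d : a <= b -> c <= d ->
  (forall x y, a <= x <= b -> c <= y <= d -> closed_at p q x y) ->
  circulation p q a b c d = 0.
Proof.
move=> ab cd pq; apply/eqP; apply: contraT => J0.
set J := circulation p q a b c d in J0.
pose w n : R := (b - a) / 2 ^+ n; pose l n : R := (d - c) / 2 ^+ n.
have p2 n : 0 < (2 : R) ^+ n by rewrite exprn_gt0.
have w0 n : 0 <= w n by rewrite divr_ge0 ?subr_ge0// ltW.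
have l0 n : 0 <= l n by rewrite divr_ge0 ?subr_ge0// ltW.
have wS n : w n = 2 * w n.+1.
  by rewrite /w exprS; field; rewrite gt_eqF.
have lS n : l n = 2 * l n.+1.
  by rewrite /l exprS; field; rewrite gt_eqF.
pose inside n (z : R * R) :=
  [/\ a <= z.1, z.1 + w n <= b, c <= z.2 & z.2 + l n <= d].
pose C n (z : R * R) := circulation p q z.1 (z.1 + w n) z.2 (z.2 + l n).
pose bad n z := inside n z /\ `|J| / 4 ^+ n <= `|C n z|.
pose next n (z z' : R * R) := [/\ bad n.+1 z', z.1 <= z'.1,
  z'.1 + w n.+1 <= z.1 + w n, z.2 <= z'.2 & z'.2 + l n.+1 <= z.2 + l n].
(* The implication stands under the existential so that choice yields a total function [F n]; where
   [z] is not bad, any value does. *)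
have step n z : exists z', bad n z -> next n z z'.
  have [[[i1 i2 i3 i4] Hz]|nb] := pselect (bad n z); last by exists z.
  have wSn := wS n; have lSn := lS n; have w1 := w0 n.+1; have l1 := l0 n.+1.
  pose z1 : R * R := (z.1 + w n.+1, z.2).
  pose z2 : R * R := (z.1, z.2 + l n.+1).
  pose z3 : R * R := (z.1 + w n.+1, z.2 + l n.+1).
  have eC : C n z = C n.+1 z + C n.+1 z2 + (C n.+1 z1 + C n.+1 z3).
    rewrite /C /=.
    rewrite (@circulation_split_x p q a b c d pq _ (z.1 + w n.+1))//; try lra.
    rewrite (@circulation_split_y p q a b c d pq z.1 _ _ (z.2 + l n.+1))//; try lra.
    rewrite (@circulation_split_y p q a b c d pq _ (z.1 + w n) _ (z.2 + l n.+1))//; try lra.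
    have -> : z.1 + w n.+1 + w n.+1 = z.1 + w n by lra.
    by have -> : z.2 + l n.+1 + l n.+1 = z.2 + l n by lra.
  have e4 : `|J| / 4 ^+ n = 4 * (`|J| / 4 ^+ n.+1).
    by rewrite exprS; field; rewrite gt_eqF// exprn_gt0.
  rewrite e4 eC in Hz; set K := `|J| / 4 ^+ n.+1 in Hz.
  have [h|h] := leP K `|C n.+1 z|.
    by exists z => _; split; [split => //; split|..]; rewrite /=; clear -i1 i2 i3 i4 wSn lSn w1 l1; lra.
  have [h1|h1] := leP K `|C n.+1 z1|.
    by exists z1 => _; split; [split => //; split|..]; rewrite /=; clear -i1 i2 i3 i4 wSn lSn w1 l1; lra.
  have [h2|h2] := leP K `|C n.+1 z2|.
    by exists z2 => _; split; [split => //; split|..]; rewrite /=; clear -i1 i2 i3 i4 wSn lSn w1 l1; lra.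
  have [h3|h3] := leP K `|C n.+1 z3|.
    by exists z3 => _; split; [split => //; split|..]; rewrite /=; clear -i1 i2 i3 i4 wSn lSn w1 l1; lra.
  have := ler_normD (C n.+1 z + C n.+1 z2) (C n.+1 z1 + C n.+1 z3).
  have := ler_normD (C n.+1 z) (C n.+1 z2); have := ler_normD (C n.+1 z1) (C n.+1 z3).
  lra.
pose F n z := projT1 (cid (step n z)).
have FP n z : bad n z -> next n z (F n z) by rewrite /F; case: cid.
pose s := fix s n := if n is m.+1 then F m (s m) else (a, c).
have sbad n : bad n (s n).
  elim: n => [|n ih]; last by have [] := FP _ _ ih.
  rewrite /bad /inside /C /w /l !expr0 !divr1/=; split; first by split; lra.
  by rewrite !(addrC _ (_ - _)) !subrK.
have snext n : next n (s n) (s n.+1) := FP _ _ (sbad n).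
have [x0 Hx] : exists x, forall n, (s n).1 <= x <= (s n).1 + w n.
  by apply: nested_intervals => n; [case: (snext n)..|have := w0 n; lra].
have [y0 Hy] : exists x, forall n, (s n).2 <= x <= (s n).2 + l n.
  by apply: nested_intervals => n; [case: (snext n)..|have := l0 n; lra].
have x0ab : a <= x0 <= b.
  by have := Hx 0; rewrite /= /w expr0 divr1; lra.
have y0cd : c <= y0 <= d.
  by have := Hy 0; rewrite /= /l expr0 divr1; lra.
pose S := (b - a) + (d - c).
have Jp : 0 < `|J| by rewrite normr_gt0.
(* The summand 1 keeps the divisor positive for a degenerate box and makes the final comparison of
   [S ^+ 2] with [S ^+ 2 + 1] strict. *)
have S1 : 0 < S ^+ 2 + 1 by rewrite ltr_wpDl// sqr_ge0.
have [r r0 H] := circulation_small pq x0ab y0cd (divr_gt0 Jp S1).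
have [n Hn] : exists n : nat, S / 2 ^+ n < r.
  have /cvgrPdist_lt/(_ _ r0) := @cvg_geometric R S 2^-1 ltac:(rewrite ger0_norm; lra).
  move=> [n _ /(_ n (leqnn n))]; rewrite sub0r normrN /= /geometric/= exprVn => h.
  by exists n; apply: le_lt_trans h; exact: ler_norm.
have [i1 i2 i3 i4] := (sbad n).1.
have := (sbad n).2.
have eS : (s n).1 + w n - (s n).1 + ((s n).2 + l n - (s n).2) = S / 2 ^+ n.
  by rewrite /w /l /S; lra.
have := H _ _ _ _ i1 (Hx n) i2 i3 (Hy n) i4; rewrite eS => /(_ Hn).
move=> h1 h2; have := le_trans h2 h1.
rewrite leNgt expr_div_n -exprM mulnC exprM.
have -> : 2 ^+ 2 = 4 :> R by lra.
rewrite mulrA ltr_pM2r ?invr_gt0 ?exprn_gt0// mulrAC ltr_pdivrMr// ltr_pM2l//.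
lra.
Qed.

(* The box minus the square splits into two vertical strips and two smaller boxes. *)
Lemma circulation_hole p q x1 x2 y1 y2 s : 0 < s ->
  x1 <= - s -> s <= x2 -> y1 <= - s -> s <= y2 ->
  (forall x y, x1 <= x <= x2 -> y1 <= y <= y2 -> s <= `|x| \/ s <= `|y| ->
    closed_at p q x y) ->
  circulation p q x1 x2 y1 y2 = circulation p q (- s) s (- s) s.
Proof.
move=> s0 xl xr yl yr pq.
have ns x : x <= - s \/ s <= x -> s <= `|x|.
  by rewrite ler_normr => -[?|->//]; apply/orP; right; lra.
have ms : - s <= s by lra.
have cp y : y1 <= y <= y2 -> s <= `|y| -> {within `[x1, x2], continuous (p ^~ y)}.
  move=> ys y0; apply: continuous_in_subspaceT => x; rewrite inE/= in_itv/= => xab.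
  by apply: (closed_at_continuous _).1; apply: pq => //; right.
have cq x : x1 <= x <= x2 -> s <= `|x| -> {within `[y1, y2], continuous (q x)}.
  move=> xs x0; apply: continuous_in_subspaceT => y; rewrite inE/= in_itv/= => xab.
  by apply: (closed_at_continuous _).2; apply: pq => //; left.
have xms : x1 <= s := le_trans xl ms.
have msx : - s <= x2 := le_trans ms xr.
have yms : y1 <= s := le_trans yl ms.
have msy : - s <= y2 := le_trans ms yr.
have g1 : circulation p q x1 (- s) y1 y2 = 0.
  apply: goursat => // [|x y /andP[? xs] yy]; first exact: le_trans msy.
  by apply: pq => //; [apply/andP; split=> //; exact: le_trans msx|left; apply: ns; left].
have g2 : circulation p q s x2 y1 y2 = 0.
  apply: goursat => // [|x y /andP[xs ?] yy]; first exact: le_trans msy.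
  by apply: pq => //; [apply/andP; split=> //; exact: le_trans xs|left; apply: ns; right].
have mid x : - s <= x <= s -> x1 <= x <= x2.
  by move=> /andP[? ?]; apply/andP; split; [exact: le_trans xl _|exact: le_trans xr].
have g3 : circulation p q (- s) s y1 (- s) = 0.
  apply: goursat => // x y /mid xx /andP[? ys].
  by apply: pq => //; [apply/andP; split=> //; exact: le_trans msy|right; apply: ns; left].
have g4 : circulation p q (- s) s s y2 = 0.
  apply: goursat => // x y /mid xx /andP[ys ?].
  by apply: pq => //; [apply/andP; split=> //; exact: le_trans ys|right; apply: ns; right].
have split3 (f : R -> R) a b : a <= - s -> s <= b -> {within `[a, b], continuous f} ->
    segint f a b = segint f a (- s) + segint f (- s) s + segint f s b.
  move=> ha hb cf; have as' : a <= s := le_trans ha ms.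
  rewrite (@segint_chasles _ a s b)//; last by rewrite as'.
  rewrite (@segint_chasles _ a (- s) s)//; first by rewrite ha.
  by apply: continuous_subspaceW cf; apply: subset_itvl; rewrite bnd_simp.
have n1 : s <= `|s| := ler_norm s.
have n2 : s <= `|- s| by rewrite normrN.
have yl' : y1 <= y2 := le_trans yms yr.
have c1 : {within `[x1, x2], continuous (p ^~ y1)}.
  by apply: cp; [rewrite lexx|apply: ns; left].
have c2 : {within `[x1, x2], continuous (p ^~ y2)}.
  by apply: cp; [rewrite lexx andbT|apply: ns; right].
have c3 : {within `[y1, y2], continuous (q s)} by apply: cq => //; rewrite xms.
have c4 : {within `[y1, y2], continuous (q (- s))} by apply: cq => //; rewrite xl.
have e1 := split3 _ _ _ xl xr c1; have e2 := split3 _ _ _ xl xr c2.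
have e3 := split3 _ _ _ yl yr c3; have e4 := split3 _ _ _ yl yr c4.
move: g1 g2 g3 g4; rewrite /circulation e1 e2 e3 e4.
by repeat (move: (segint _ _ _) => ?); lra.
Qed.

End Goursat.

(** * Complex derivatives *)

Lemma is_derive_comp1 (F : numFieldType) (f g : F -> F) (x a b : F) :
  is_derive x 1 g b -> is_derive (g x) 1 f a ->
  is_derive x 1 (fun y => f (g y)) (a * b).
Proof.
move=> [/derivable1_diffP dg <-] [/derivable1_diffP df <-].
have dfg := differentiable_comp dg df; split; first exact/derivable1_diffP.
have -> : 'D_1 (fun y => f (g y)) x = 'd (f \o g) x 1 by exact: deriveE.
rewrite (diff_comp dg df) (deriveE _ dg) (deriveE _ df).
rewrite -[X in 'd f _ X = _]mulr1 -[X in 'd f _ X = _]/(_ *: _).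
by rewrite [LHS]linearZ [LHS]/(_ * _) mulrC.
Qed.

Section Complex.
Variable R : realType.
Local Notation C := R[i].
Implicit Types (z w l : C) (f g : C -> C) (e d : R).
Local Open Scope complex_scope.

Lemma normc_cmod z : `|z| = (cmod z)%:C.
Proof. exact: normc_def. Qed.

Lemma cmod_ge0 z : 0 <= cmod z.
Proof. exact: sqrtr_ge0. Qed.

Lemma cmodM z w : cmod (z * w) = cmod z * cmod w.
Proof. by apply: complexI; rewrite rmorphM/= -!normc_cmod normrM. Qed.

Lemma cmodV z : cmod z^-1 = (cmod z)^-1.
Proof. by apply: complexI; rewrite fmorphV/= -!normc_cmod normfV. Qed.

Lemma cmodN z : cmod (- z) = cmod z.
Proof. by apply: complexI; rewrite -!normc_cmod normrN. Qed.

Lemma cmodBC z w : cmod (z - w) = cmod (w - z).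
Proof. by rewrite -cmodN opprB. Qed.

Lemma cmodJ z : cmod z^* = cmod z.
Proof. by apply: complexI; rewrite -!normc_cmod normcJ. Qed.

Lemma cmodX z n : cmod (z ^+ n) = cmod z ^+ n.
Proof. by apply: complexI; rewrite rmorphXn/= -!normc_cmod normrX. Qed.

Lemma cmod0 : cmod (0 : C) = 0.
Proof. by apply: complexI; rewrite -!normc_cmod normr0. Qed.

Lemma cmod1 : cmod (1 : C) = 1.
Proof. by apply: complexI; rewrite -!normc_cmod normr1. Qed.

Lemma cmod_real (x : R) : cmod x%:C = `|x|.
Proof. by rewrite /cmod/= expr0n addr0 sqrtr_sqr. Qed.

Lemma cmod_eq0 z : (cmod z == 0) = (z == 0).
Proof. by rewrite -[RHS]normr_eq0 normc_cmod -(inj_eq (@complexI R)). Qed.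

Lemma cmod_gt0 z : (0 < cmod z) = (z != 0).
Proof. by rewrite lt_def cmod_ge0 andbT cmod_eq0. Qed.

Lemma cmodD z w : cmod (z + w) <= cmod z + cmod w.
Proof. by rewrite -lecR rmorphD/= -!normc_cmod ler_normD. Qed.

Lemma cmodB z w : cmod (z - w) <= cmod z + cmod w.
Proof. by rewrite -(cmodN w) cmodD. Qed.

Lemma cmodBl z w : cmod z - cmod w <= cmod (z - w).
Proof. by rewrite lerBlDr -{1}(subrK w z) cmodD. Qed.

Lemma sqr_cmod z : cmod z ^+ 2 = complex.Re z ^+ 2 + complex.Im z ^+ 2.
Proof. by rewrite sqr_sqrtr// addr_ge0// sqr_ge0. Qed.

Lemma sqr_cmodC z : (cmod z ^+ 2)%:C = z * z^*.
Proof. by rewrite rmorphXn/= -normc_cmod sqr_normc. Qed.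

Lemma Re_le_cmod z : `|complex.Re z| <= cmod z.
Proof. by rewrite -lecR -normc_cmod normc_ge_Re. Qed.

Lemma Im_le_cmod z : `|complex.Im z| <= cmod z.
Proof.
by rewrite -sqrtr_sqr ler_wsqrtr// lerDr sqr_ge0.
Qed.

Lemma cmod_le_ReIm z : cmod z <= `|complex.Re z| + `|complex.Im z|.
Proof.
rewrite -ler_sqr ?nnegrE ?cmod_ge0 ?addr_ge0// sqr_cmod sqrrD !real_normK ?num_real//.
by rewrite lerD2r lerDl mulrn_wge0// mulr_ge0.
Qed.

Lemma ReM z w : complex.Re (z * w) =
  complex.Re z * complex.Re w - complex.Im z * complex.Im w.
Proof. by case: z; case: w. Qed.

Lemma ImM z w : complex.Im (z * w) =
  complex.Re z * complex.Im w + complex.Im z * complex.Re w.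
Proof. by case: z; case: w. Qed.

Lemma ReB z w : complex.Re (z - w) = complex.Re z - complex.Re w.
Proof. by case: z; case: w. Qed.

Lemma ImB z w : complex.Im (z - w) = complex.Im z - complex.Im w.
Proof. by case: z; case: w. Qed.

Definition cder f z l := @is_derive C C^o C^o z 1 f l.

(** The norm of [R[i]] takes values in [R[i]], so the filter definition has complex radii. A
    positive one is real, which gives this form with real moduli, the entry point for Cauchy-Riemann
    and for derivatives along rays. *)
Lemma cderP f z l : cder f z l <-> forall e, 0 < e -> exists2 d, 0 < d &
  forall w, cmod (w - z) < d ->
    cmod (f w - f z - l * (w - z)) <= e * cmod (w - z).
Proof.
set q : C^o -> C^o := fun h => h^-1 *: ((f : C^o -> C^o) (h *: (1 : C^o) + z) - f z).
have qE (h : C) : h != 0 ->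
    cmod (l - q h) = cmod (f (h + z) - f z - l * h) / cmod h.
  move=> h0; rewrite -cmodV -cmodM cmodBC; congr cmod.
  rewrite /q -[X in X - _]/(h^-1 * (f (h * 1 + z) - f z)) mulr1.
  by rewrite mulrBl -mulrA mulfV// mulr1 mulrC.
split=> [[df dE] e e0|H].
  have /cvgrPdist_le : q @ (0 : C^o)^' --> (l : C^o) by rewrite -dE; exact: df.
  have e0' : 0 < e%:C by rewrite ltcR.
  move=> /(_ _ e0'); rewrite near_withinE => /nbhs_ballP[d /= d0 Hd].
  have dr : d = (complex.Re d)%:C.
    by rewrite RRe_real// realE ltW.
  rewrite dr ltcR in d0; exists (complex.Re d) => // w wd.
  have [->|wz] := eqVneq w z; first by rewrite !subrr mulr0 subr0 cmod0 mulr0.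
  have h0 : w - z != 0 by rewrite subr_eq0.
  have := Hd (w - z); rewrite /ball/= sub0r normrN => /(_ _ h0).
  rewrite normc_cmod {1}dr ltcR => /(_ wd).
  by rewrite -/(q _) normc_cmod lecR qE// subrK ler_pdivrMr ?cmod_gt0.
have ql : q @ (0 : C^o)^' --> (l : C^o).
  apply/cvgrPdist_le => /= e e0.
  have er : e = (complex.Re e)%:C by rewrite RRe_real// realE ltW.
  rewrite er ltcR in e0; have [d d0 Hd] := H _ e0.
  rewrite near_withinE; apply/nbhs_ballP; exists d%:C; first by rewrite /= ltcR.
  move=> h; rewrite /ball/= sub0r normrN normc_cmod ltcR => hd h0.
  rewrite normc_cmod er lecR -/(q _) qE// ler_pdivrMr ?cmod_gt0//.
  by have := Hd (h + z); rewrite addrK; exact.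
by split; [apply/cvg_ex; exists l|exact: cvg_lim].
Qed.

Lemma cder_dd f z l : cder f z l -> dd f z = l.
Proof. by move=> fzl; rewrite /dd derive1E; case: fzl. Qed.

Lemma holo_cder f z : holo f -> disk z -> cder f z (dd f z).
Proof. by move=> hf /hf fz; rewrite /dd derive1E; exact: derivableP. Qed.

Lemma cder_holo f (df : C -> C) : (forall z, disk z -> cder f z (df z)) -> holo f.
Proof. by move=> H z /H[]. Qed.

Lemma cder_cst (c : C) z : cder (fun=> c) z 0.
Proof. exact: is_derive_cst. Qed.

Lemma cder_id z : cder id z 1.
Proof. exact: is_derive_id. Qed.

Lemma cderD f g z l l' : cder f z l -> cder g z l' ->
  cder (fun w => f w + g w) z (l + l').
Proof. exact: is_deriveD. Qed.

Lemma cderB f g z l l' : cder f z l -> cder g z l' ->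
  cder (fun w => f w - g w) z (l - l').
Proof. exact: is_deriveB. Qed.

Lemma cderM f g z l l' : cder f z l -> cder g z l' ->
  cder (fun w => f w * g w) z (f z * l' + g z * l).
Proof. exact: is_deriveM. Qed.

Lemma cderV f z l : f z != 0 -> cder f z l ->
  cder (fun w => (f w)^-1) z (- l / f z ^+ 2).
Proof.
move=> fz0 [df <-]; split; first exact: derivableV.
by rewrite deriveV// mulNr mulrC -mulNr.
Qed.

Lemma cder_comp f g z l l' : cder g z l -> cder f (g z) l' ->
  cder (fun w => f (g w)) z (l' * l).
Proof.
exact: is_derive_comp1.
Qed.

Lemma cder_eq f z l l' : cder f z l -> l = l' -> cder f z l'.
Proof. by move=> + <-. Qed.

(* By the Cauchy-Riemann equations, [Im f dx + Re f dy = Im (f dz)] is closed. *)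
Lemma cder_closed_at f (x y : R) l : cder f (x +i* y) l ->
  closed_at (fun x y => complex.Im (f (x +i* y)))
            (fun x y => complex.Re (f (x +i* y))) x y.
Proof.
move=> /cderP fl; exists (complex.Im l), (complex.Re l), (- complex.Im l) => e e0.
have [d d0 H] := fl e e0; exists (d / 2); first by rewrite divr_gt0.
move=> x' y' xd yd.
have le : cmod ((x' +i* y') - (x +i* y)) <= `|x' - x| + `|y' - y|.
  by apply: le_trans (cmod_le_ReIm _) _.
have := H (x' +i* y'); have -> : cmod (x' +i* y' - x +i* y) < d.
  by apply: (le_lt_trans le); lra.
move=> /(_ isT) K; have {}K := le_trans K (ler_wpM2l (ltW e0) le).
split.
  apply: le_trans (le_trans (Im_le_cmod _) K).
  by rewrite !ImB ImM !ImB !ReB/= le_eqVlt; apply/orP; left; apply/eqP; congr `|_|; ring.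
apply: le_trans (le_trans (Re_le_cmod _) K).
by rewrite !ReB ReM !ImB !ReB/= le_eqVlt; apply/orP; left; apply/eqP; congr `|_|; ring.
Qed.

End Complex.

(** * Measurability in the plane *)

Section PlaneMeasure.
Variable R : realType.
Local Notation RR := (measurableTypeR R * measurableTypeR R)%type.

(** An open set is the union of the countably many boxes with rational centre and half-width that it
    contains: a half-width [e < r / 2] and a centre within [e] of the point keep the box in the ball
    of radius [r]. *)
Lemma open_measurable_plane (O : set (R * R)) : open O -> measurable (O : set RR).
Proof.
move=> oO.
pose box (a b e : rat) : set RR :=
  `]ratr a - ratr e, ratr a + ratr e[ `*` `]ratr b - ratr e, ratr b + ratr e[.
pose B (a b e : rat) : set RR := [set p | box a b e p /\ box a b e `<=` O].
have -> : (O : set RR) = \bigcup_a \bigcup_b \bigcup_e B a b e.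
  apply/seteqP; split=> [[x y] Oxy|p [a _ [b _ [e _ []]]]]; last by move=> ? /(_ p); exact.
  have /nbhs_ballP[r /= r0 Hr] := open_nbhs_nbhs (conj oO Oxy).
  have /rat_in_itvoo[e] : 0 < r / 2 by rewrite divr_gt0.
  rewrite in_itv/= => /andP[e0 er].
  have /rat_in_itvoo[a] : x - ratr e < x + ratr e by lra.
  have /rat_in_itvoo[b] : y - ratr e < y + ratr e by lra.
  rewrite !in_itv/= => /andP[b1 b2] /andP[a1 a2].
  exists a => //; exists b => //; exists e => //; split.
    by split; rewrite /= in_itv/=; lra.
  move=> [u v] [/=]; rewrite !in_itv/= => /andP[u1 u2] /andP[v1 v2].
  by apply: Hr; split; rewrite /ball/= ltr_norml; lra.
do 3! (apply: bigcupT_measurable_rat => ?).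
rewrite /B; set A := box _ _ _.
have [AO|AO] := pselect (A `<=` O); last first.
  by rewrite (_ : mkset _ = set0)//; apply/seteqP; split=> p // -[].
rewrite (_ : mkset _ = A); last by apply/seteqP; split=> p // -[].
by apply: measurableX; exact: measurable_itv.
Qed.

Lemma continuous_measurable_plane (D : set (R * R)) (f : R * R -> R) :
  open D -> (forall p, D p -> {for p, continuous f}) ->
  measurable_fun (D : set RR) (f : RR -> measurableTypeR R).
Proof.
move=> oD cf; apply: (measurability _ (@measurable_realfun.RGenOInfty.measurableE R)).
move=> _ [_ [x ->] <-]; apply: open_measurable_plane.
rewrite openE => p [Dp]; rewrite /= in_itv/= andbT => xfp.
have nD : nbhs p D by apply: open_nbhs_nbhs.
have nf : \forall q \near p, x < f q by exact: (cvgr_gt _ (cf p Dp)).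
by apply: filterS2 nD nf => q Dq fq; split => //=; rewrite in_itv/= andbT.
Qed.

Lemma open_disk2 : open (@disk2 R).
Proof.
have c : continuous (fun p : R * R => p.1 ^+ 2 + p.2 ^+ 2).
  move=> p; apply: cvgD; rewrite !expr2; apply: cvgM;
    (exact: cvg_fst || exact: cvg_snd).
by have := (continuousP _).1 c _ (@open_lt R 1).
Qed.

Lemma measurable_disk2 : measurable (@disk2 R : set RR).
Proof. exact: open_measurable_plane open_disk2. Qed.

End PlaneMeasure.

(** * The derivative at the centre and the area norm *)

Lemma continuous_pairl (T U : topologicalType) (y : U) :
  continuous (fun x : T => (x, y)).
Proof.
move=> x A [[B1 B2] /= [Bx By] BA]; apply: filterS Bx => t Bt.
by apply: BA; split => //; exact: nbhs_singleton By.
Qed.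

Lemma continuous_pairr (T U : topologicalType) (x : T) :
  continuous (fun y : U => (x, y)).
Proof.
move=> y A [[B1 B2] /= [Bx By] BA]; apply: filterS By => t Bt.
by apply: BA; split => //; exact: nbhs_singleton Bx.
Qed.

Section Area.
Variable R : realType.
Local Notation C := R[i].
Local Open Scope complex_scope.
Implicit Types (x y s : R).

Lemma continuous_sqr_holo (h : C -> C) x y : holo h -> disk (x +i* y) ->
  {for (x, y), continuous (fun r : R * R => cmod (h (r.1 +i* r.2)) ^+ 2)}.
Proof.
move=> hh dxy; have [+ _] := cderP h (x +i* y) (dd h (x +i* y)).
move=> /(_ (holo_cder hh dxy) 1 ltr01)[d d0 H].
set l := dd h _ in H; have l0 := cmod_ge0 l.
suff cc : {for (x, y), continuous (fun r : R * R => cmod (h (r.1 +i* r.2)))}.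
  by move=> ?; rewrite /continuous_at !expr2; apply: cvgM; exact: cc.
apply/cvgrPdist_lt => /= e e0.
pose r := Num.min (d / 2) (e / (2 * (1 + cmod l))).
have r0 : 0 < r by rewrite lt_min !divr_gt0// mulr_gt0// ltr_pwDl.
exists (ball x r, ball y r) => /=; first by split; exact: nbhsx_ballx.
move=> [u v] [/=]; rewrite /ball/= => ux vy.
have le : cmod ((u +i* v) - (x +i* y)) <= `|x - u| + `|y - v|.
  by apply: le_trans (cmod_le_ReIm _) _; rewrite /= (distrC x) (distrC y).
have lt : cmod ((u +i* v) - (x +i* y)) < 2 * r by apply: le_lt_trans le _; lra.
have rd : 2 * r <= d.
  by have : r <= d / 2; [rewrite ge_min lexx|lra].
have re : 2 * r * (1 + cmod l) <= e.
  have : r <= e / (2 * (1 + cmod l)) by rewrite ge_min lexx orbT.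
  by rewrite ler_pdivlMr ?mulr_gt0 ?ltr_pwDl//; lra.
have {}H := H _ (lt_le_trans lt rd).
set w := u +i* v in le lt H *; set z := x +i* y in le lt H *.
have h1 : cmod (h w - h z) <= (1 + cmod l) * cmod (w - z).
  rewrite -[h w - h z](subrK (l * (w - z))) (le_trans (cmodD _ _))//.
  by rewrite cmodM mulrDl lerD.
have h2 : cmod (h w - h z) < e.
  apply: le_lt_trans h1 _; apply: lt_le_trans re.
  by rewrite mulrC ltr_pM2r// ltr_pwDl.
have h3 := cmodBl (h w) (h z); have h4 := cmodBl (h z) (h w).
by rewrite (cmodBC (h z)) in h4; rewrite ltr_norml; lra.
Qed.

Lemma disk_box x y : - (1 / 2) <= x <= 1 / 2 -> - (1 / 2) <= y <= 1 / 2 ->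
  disk (x +i* y).
Proof.
move=> hx hy; rewrite /disk/= -[ltRHS]sqrtr1 ltr_sqrt//=; nra.
Qed.

Lemma continuous_row (h : C -> C) y : holo h -> - (1 / 2) <= y <= 1 / 2 ->
  {within `[- (1 / 2), 1 / 2], continuous (fun x => cmod (h (x +i* y)) ^+ 2)}.
Proof.
move=> hh hy; apply: continuous_in_subspaceT => x; rewrite inE/= in_itv/= => hx.
have ch := continuous_sqr_holo hh (disk_box hx hy).
by apply: (continuous_comp (f := fun x => (x, y))) ch; exact: continuous_pairl.
Qed.

Lemma continuous_col (h : C -> C) x : holo h -> - (1 / 2) <= x <= 1 / 2 ->
  {within `[- (1 / 2), 1 / 2], continuous (fun y => cmod (h (x +i* y)) ^+ 2)}.
Proof.
move=> hh hx; apply: continuous_in_subspaceT => y; rewrite inE/= in_itv/= => hy.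
have ch := continuous_sqr_holo hh (disk_box hx hy).
by apply: (continuous_comp (f := fun y => (x, y))) ch; exact: continuous_pairr.
Qed.

Section kernel.
Variables (h : C -> C).
Hypotheses (hh : holo h) (h0 : h 0 = 0).
Let m := cmod (dd h 0).
Hypothesis m0 : 0 < m.

(** A rotation taking [h'(0)] to the positive real [m]: the kernel [k] then has residue [m] at 0,
    and [|k|] does not depend on [c]. *)
Let c : C := (dd h 0)^* / m%:C.

Let cmodc : cmod c = 1.
Proof. by rewrite /c cmodM cmodV cmodJ cmod_real -/m gtr0_norm// divff// gt_eqF. Qed.

Let k (z : C) := c * h z / z ^+ 2.

Let dk z : disk z -> z != 0 -> exists l, cder k z l.
Proof.
move=> dz z0; eexists; apply: cderM; first apply: cderM.
- exact: cder_cst.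
- exact: holo_cder.
- apply: cderV; first by rewrite expf_neq0.
  by apply: cderM; exact: cder_id.
Qed.

Let cdd : c * dd h 0 = m%:C.
Proof.
have mn0 : m%:C != 0 :> C by rewrite -cmod_eq0 cmod_real gtr0_norm// gt_eqF.
apply: (mulfI mn0); rewrite /c mulrA mulrCA mulfV// mulr1 mulrC -sqr_cmodC.
by rewrite -/m rmorphXn expr2.
Qed.

(** Near 0, [k w] is close to [m / w = t * w^*] with [t = m / |w|^2]. The range allowed for [|w|] is
    the one met on the boundary of the square of half-side [s]. *)
Let near_pole s w : 0 < s -> s <= cmod w -> cmod w ^+ 2 <= 2 * s ^+ 2 ->
  cmod (h w - dd h 0 * w) <= m / 8 * cmod w ->
  exists2 t, [/\ `|complex.Re (k w) - t * complex.Re w| <= m / (8 * s) &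
              `|complex.Im (k w) + t * complex.Im w| <= m / (8 * s)] &
           m / (2 * s ^+ 2) <= t.
Proof.
move=> s0 sw w2 Hw.
have w0 : 0 < cmod w by exact: lt_le_trans sw.
have wn0 : w != 0 by rewrite -cmod_gt0.
pose t := m / cmod w ^+ 2; exists t; last first.
  by rewrite /t ler_pM2l// lef_pV2// posrE ?exprn_gt0// mulr_gt0// exprn_gt0.
have e : t%:C * w^* = m%:C / w.
  by rewrite /t rmorphM/= fmorphV/= sqr_cmodC invfM mulrA divfK// conjc_eq0.
have K : cmod (k w - t%:C * w^*) <= m / (8 * s).
  have -> : k w - t%:C * w^* = c * (h w - dd h 0 * w) / w ^+ 2.
    rewrite e /k mulrBr mulrA cdd mulrBl; congr (_ - _).
    by rewrite expr2 invfM mulrA mulfK.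
  rewrite [cmod (_ / _)]cmodM [cmod (c * _)]cmodM cmodc mul1r cmodV cmodX ler_pdivrMr ?exprn_gt0//.
  apply: (le_trans Hw).
  have -> : m / (8 * s) * cmod w ^+ 2 = m / 8 * cmod w * (cmod w / s).
    by field; rewrite gt_eqF.
  by rewrite ler_peMr ?ler_pdivlMr ?mul1r// !mulr_ge0// ltW.
have er : complex.Re (t%:C * w^*) = t * complex.Re w by case: (w) => a b /=; rewrite mul0r subr0.
have ei : complex.Im (t%:C * w^*) = - (t * complex.Im w).
  by case: (w) => a b /=; rewrite mul0r addr0 mulrN.
split; apply: le_trans K.
  by apply: le_trans (Re_le_cmod _); rewrite ReB er.
by apply: le_trans (Im_le_cmod _); rewrite ImB ei opprK.
Qed.

Let p x y := complex.Im (k (x +i* y)).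
Let q x y := complex.Re (k (x +i* y)).

Let pq_closed x y : - (1 / 2) <= x <= 1 / 2 -> - (1 / 2) <= y <= 1 / 2 ->
  (x != 0) || (y != 0) -> closed_at p q x y.
Proof.
move=> hx hy xy; have [l kl] : exists l, cder k (x +i* y) l.
  apply: dk; first exact: disk_box.
  by rewrite eq_complex/= negb_and.
exact: cder_closed_at kl.
Qed.

(** The residue theorem would give 2 pi m. Here the integrand, taken with the sign of its side, is
    at least m / (2 s) - m / (8 s) = 3 m / (8 s) on each of four sides of length 2 s, so each side
    gives 3 m / 4. *)
Let circulation_lower : exists2 s, 0 < s < 1 / 4 & 3 * m <= circulation p q (- s) s (- s) s.
Proof.
have D0 : disk (0 : C) by rewrite /disk/= cmod0.
have [+ _] := cderP h 0 (dd h 0).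
move=> /(_ (holo_cder hh D0) (m / 8) (divr_gt0 m0 (ltr0Sn R 7)))[d d0 H].
have {}H w : cmod w < d -> cmod (h w - dd h 0 * w) <= m / 8 * cmod w.
  by have := H w; rewrite h0 !subr0.
(* Points of the square have modulus at most [2 * s < d], and [s <= 1 / 8] keeps the square inside
   all the boxes it is compared with. *)
pose s := Num.min (1 / 8) (d / 3).
have s0 : 0 < s by rewrite lt_min; apply/andP; split; lra.
have [s1 s2] : s <= 1 / 8 /\ s <= d / 3 by rewrite /s !ge_min !lexx orbT.
exists s; first by lra.
have bnd x y : `|x| <= s -> `|y| <= s -> (`|x| = s \/ `|y| = s) ->
  exists2 t, [/\ `|q x y - t * x| <= m / (8 * s) &
              `|p x y + t * y| <= m / (8 * s)] &
           m / (2 * s ^+ 2) <= t.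
  move=> xs ys xys; apply: near_pole => //.
  - by case: xys => <-; [exact: (Re_le_cmod (x +i* y))|exact: (Im_le_cmod (x +i* y))].
  - rewrite sqr_cmod /= -[x ^+ 2]real_normK ?num_real// -[y ^+ 2]real_normK ?num_real//.
    have := normr_ge0 x; have := normr_ge0 y; nra.
  - apply: H; apply: le_lt_trans (cmod_le_ReIm _) _; rewrite /=; lra.
have e1 : m / (8 * s) * 4 = m / (2 * s ^+ 2) * s by field; rewrite gt_eqF.
have e2 : m / (8 * s) * s = m / 8 by field; rewrite gt_eqF.
set u := m / (8 * s) in bnd e1 e2; set v := m / (2 * s ^+ 2) in bnd e1.
have ns : `|s| = s by rewrite gtr0_norm.
have nms : `|- s| = s by rewrite normrN.
have nx x : - s <= x <= s -> `|x| <= s by rewrite ler_norml.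
have q1 y : - s <= y <= s -> 3 * u <= q s y.
  move=> /nx ys; have [||t [+ _ vt]] := bnd s y _ ys; rewrite ?ns//; first by left.
  by rewrite ler_norml => /andP[? ?]; nra.
have q2 y : - s <= y <= s -> q (- s) y <= - (3 * u).
  move=> /nx ys; have [||t [+ _ vt]] := bnd (- s) y _ ys; rewrite ?nms//; first by left.
  by rewrite ler_norml => /andP[? ?]; nra.
have p1 x : - s <= x <= s -> 3 * u <= p x (- s).
  move=> /nx xs; have [||t [_ + vt]] := bnd x (- s) xs; rewrite ?nms//; first by right.
  by rewrite ler_norml => /andP[? ?]; nra.
have p2 x : - s <= x <= s -> p x s <= - (3 * u).
  move=> /nx xs; have [||t [_ + vt]] := bnd x s xs; rewrite ?ns//; first by right.
  by rewrite ler_norml => /andP[? ?]; nra.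
have ms : - s <= s by lra.
have sn0 : s != 0 by rewrite gt_eqF.
have msn0 : - s != 0 by rewrite oppr_eq0.
have ccst (z : R) : {within `[- s, s], continuous (cst z : R -> R)}.
  by apply: continuous_subspaceT => x; exact: cst_continuous.
have cp y : y = s \/ y = - s -> {within `[- s, s], continuous (p ^~ y)}.
  move=> ys; apply: continuous_in_subspaceT => x; rewrite inE/= in_itv/= => xab.
  apply: (closed_at_continuous _).1; apply: pq_closed; [lra|case: ys => ->; lra|].
  by case: ys => ->; rewrite ?sn0 ?msn0 orbT.
have cq x : x = s \/ x = - s -> {within `[- s, s], continuous (q x)}.
  move=> ys; apply: continuous_in_subspaceT => y; rewrite inE/= in_itv/= => xab.
  apply: (closed_at_continuous _).2; apply: pq_closed; [case: ys => ->; lra|lra|].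
  by case: ys => ->; rewrite ?sn0 ?msn0.
have := segint_le (ccst _) (cq s (or_introl erefl)) q1.
have := segint_le (cq (- s) (or_intror erefl)) (ccst _) q2.
have := segint_le (ccst _) (cp (- s) (or_intror erefl)) p1.
have := segint_le (cp s (or_introl erefl)) (ccst _) p2.
rewrite !segint_cst// /circulation.
have -> : 3 * u * (s - - s) = 3 / 4 * m by rewrite opprK; lra.
have -> : - (3 * u) * (s - - s) = - (3 / 4 * m) by rewrite opprK; lra.
lra.
Qed.

Let circulation_box x1 x2 y1 y2 : - (1 / 2) <= x1 <= - (1 / 4) ->
  1 / 4 <= x2 <= 1 / 2 -> - (1 / 2) <= y1 <= - (1 / 4) -> 1 / 4 <= y2 <= 1 / 2 ->
  3 * m <= circulation p q x1 x2 y1 y2.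
Proof.
move=> hx1 hx2 hy1 hy2; have [s s0 /le_trans->//] := circulation_lower.
rewrite (@circulation_hole _ p q x1 x2 y1 y2 s)//; try lra.
move=> x y xx yy xy; apply: pq_closed; [lra|lra|].
by apply/orP; case: xy => ?; [left|right]; rewrite -normr_gt0; lra.
Qed.

Let F x y := cmod (h (x +i* y)) ^+ 2.

(** Since [|w| >= 1 / 4], [|k| <= 16 |h|]; then AM-GM. Its weights make the constant term [m / 2]:
    four sides of length at most 1 cost [2 * m] out of the [3 * m] of [circulation_box], and [m] is
    left. *)
Let cmod_k_le x y : 1 / 4 <= `|x| \/ 1 / 4 <= `|y| ->
  cmod (k (x +i* y)) <= 128 / m * F x y + m / 2.
Proof.
move=> xy; set w := x +i* y; have w4 : 1 / 4 <= cmod w.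
  by case: xy => /le_trans; apply; [exact: (Re_le_cmod w)|exact: (Im_le_cmod w)].
rewrite /F -/w /k [cmod (_ / _)]cmodM [cmod (c * _)]cmodM cmodc mul1r cmodV cmodX.
set t := cmod (h w); have t0 : 0 <= t by exact: cmod_ge0.
apply: (@le_trans _ _ (16 * t)).
  rewrite ler_pdivrMr ?exprn_gt0//; last by lra.
  have : 1 / 16 <= cmod w ^+ 2 by nra.
  by move: (cmod w ^+ 2) => W ?; nra.
rewrite -subr_ge0 (_ : _ - _ = (16 * t - m) ^+ 2 / (2 * m)); last first.
  by field; rewrite gt_eqF.
by rewrite divr_ge0 ?sqr_ge0// mulr_ge0// ltW.
Qed.

(* The Cauchy integral of [h / z^2] over the boundary of the box, with
   [|h| <= |h|^2 / m + m / 4] (up to constants) to avoid Cauchy-Schwarz. *)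
Lemma box_l2_bound x1 x2 y1 y2 : - (1 / 2) <= x1 <= - (1 / 4) ->
  1 / 4 <= x2 <= 1 / 2 -> - (1 / 2) <= y1 <= - (1 / 4) -> 1 / 4 <= y2 <= 1 / 2 ->
  m ^+ 2 <= 128 * (segint (F ^~ y1) (- (1 / 2)) (1 / 2) +
    segint (F ^~ y2) (- (1 / 2)) (1 / 2) + segint (F x1) (- (1 / 2)) (1 / 2) +
    segint (F x2) (- (1 / 2)) (1 / 2)).
Proof.
move=> hx1 hx2 hy1 hy2; have := circulation_box hx1 hx2 hy1 hy2.
have side (f g : R -> R) a b : - (1 / 2) <= a -> a <= b -> b <= 1 / 2 ->
    {within `[- (1 / 2), 1 / 2], continuous g} -> (forall t, 0 <= g t) ->
    {within `[a, b], continuous f} ->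
    (forall t, a <= t <= b -> `|f t| <= 128 / m * g t + m / 2) ->
    `|segint f a b| <= 128 / m * segint g (- (1 / 2)) (1 / 2) + m / 2.
  move=> ha ab hb cg g0 cf fg.
  have cg' : {within `[a, b], continuous g}.
    by apply: continuous_subspaceW cg; apply: subset_itv; rewrite bnd_simp.
  have cG : {within `[a, b], continuous (fun t => 128 / m * g t + m / 2)}.
    move=> t; apply: cvgD; last exact: cvg_cst.
    by apply: cvgM; [exact: cvg_cst|exact: cg'].
  apply: (le_trans (segint_norm_le cf cG fg)); rewrite segint_affine//.
  apply: lerD; last by rewrite ger_pMr//; [lra|exact: divr_gt0].
  by rewrite ler_pM2l ?divr_gt0//; apply: segint_subitv.
have cp y : - (1 / 2) <= y <= 1 / 2 -> y != 0 -> {within `[x1, x2], continuous (p ^~ y)}.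
  move=> ys yn0; apply: continuous_in_subspaceT => x; rewrite inE/= in_itv/= => xab.
  by apply: (closed_at_continuous _).1; apply: pq_closed; [lra|lra|rewrite yn0 orbT].
have cq x : - (1 / 2) <= x <= 1 / 2 -> x != 0 -> {within `[y1, y2], continuous (q x)}.
  move=> xs xn0; apply: continuous_in_subspaceT => y; rewrite inE/= in_itv/= => xab.
  by apply: (closed_at_continuous _).2; apply: pq_closed; [lra|lra|rewrite xn0].
have sp y : - (1 / 2) <= y <= 1 / 2 -> 1 / 4 <= `|y| ->
    `|segint (p ^~ y) x1 x2| <= 128 / m * segint (F ^~ y) (- (1 / 2)) (1 / 2) + m / 2.
  move=> hy y4; apply: side; try lra.
  - exact: continuous_row.
  - by move=> t; exact: sqr_ge0.
  - by apply: cp => //; rewrite -normr_gt0; lra.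
  - by move=> t _; apply: le_trans (Im_le_cmod _) _; apply: cmod_k_le; right.
have sq x : - (1 / 2) <= x <= 1 / 2 -> 1 / 4 <= `|x| ->
    `|segint (q x) y1 y2| <= 128 / m * segint (F x) (- (1 / 2)) (1 / 2) + m / 2.
  move=> hx x4; apply: side; try lra.
  - exact: continuous_col.
  - by move=> t; exact: sqr_ge0.
  - by apply: cq => //; rewrite -normr_gt0; lra.
  - by move=> t _; apply: le_trans (Re_le_cmod _) _; apply: cmod_k_le; left.
have ax1 : 1 / 4 <= `|x1| by rewrite -normrN ger0_norm; lra.
have ax2 : 1 / 4 <= `|x2| by rewrite ger0_norm; lra.
have ay1 : 1 / 4 <= `|y1| by rewrite -normrN ger0_norm; lra.
have ay2 : 1 / 4 <= `|y2| by rewrite ger0_norm; lra.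
have := sp y1 ltac:(lra) ay1; have := sp y2 ltac:(lra) ay2.
have := sq x1 ltac:(lra) ax1; have := sq x2 ltac:(lra) ax2.
move=> h1 h2 h3 h4 h5; set S := (X in _ <= 128 * X).
suff : m <= 128 / m * S by rewrite mulrAC ler_pdivlMr// -expr2.
move: h1 h2 h3 h4 h5; rewrite /circulation !ler_norml /S !mulrDr.
repeat (move: (segint (p ^~ _) x1 x2) => ?).
repeat (move: (segint (q _) y1 y2) => ?).
repeat (move: (128 / m * _) => ?).
move=> /andP[? ?] /andP[? ?] /andP[? ?] /andP[? ?] ?; lra.
Qed.

End kernel.
End Area.

(** * From boundary integrals to the area integral *)

Lemma disk2_disk (R : realType) (r : R * R) : disk2 r -> disk (r.1 +i* r.2)%C.
Proof. by rewrite /disk2 /disk/= => r1; rewrite -[ltRHS]sqrtr1 ltr_sqrt. Qed.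

Lemma measurable_sqr_holo (R : realType) (h : R[i] -> R[i]) : holo h ->
  measurable_fun (@disk2 R : set (measurableTypeR R * measurableTypeR R))
    (fun r : measurableTypeR R * measurableTypeR R =>
       (cmod (h (r.1 +i* r.2)%C) ^+ 2)%:E).
Proof.
move=> hh; apply/measurable_EFinP.
apply: (continuous_measurable_plane (f := fun r => cmod (h (r.1 +i* r.2)%C) ^+ 2) (@open_disk2 R)).
by move=> [x y] Dxy; apply: continuous_sqr_holo => //; exact: disk2_disk Dxy.
Qed.

Section DerivL2.
Variable R : realType.
Local Notation C := R[i].
Local Open Scope complex_scope.
Variable h : C -> C.
Hypothesis hh : holo h.

Let F (x y : R) := cmod (h (x +i* y)) ^+ 2.

Let cFx y : - (1 / 2) <= y <= 1 / 2 ->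
  {within `[- (1 / 2), 1 / 2], continuous (F ^~ y)}.
Proof. exact: continuous_row. Qed.

Let cFy x : - (1 / 2) <= x <= 1 / 2 ->
  {within `[- (1 / 2), 1 / 2], continuous (F x)}.
Proof. exact: continuous_col. Qed.

Local Notation mu := (@lebesgue_measure R).
Local Notation I := (\int[(mu \x mu)%E]_(r in @disk2 R) ((cmod (h (r.1 +i* r.2)) ^+ 2)%:E))%E.
Local Notation RR := (measurableTypeR R * measurableTypeR R)%type.
Local Notation J := `[(- (1 / 2) : R), 1 / 2]%classic.

(** Extended by 0 outside the square, so that Tonelli applies on the whole plane and the sections
    over [J] are integrals over the fixed interval [J]. *)
Let Phi : RR -> \bar R := (fun r : RR => (F r.1 r.2)%:E) \_ (J `*` J).

Let box_disk2 : J `*` J `<=` @disk2 R.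
Proof.
move=> [x y] [/=]; rewrite !in_itv/= => /andP[? ?] /andP[? ?]; rewrite /disk2/=; nra.
Qed.

Let mJJ : measurable (J `*` J : set RR).
Proof. by apply: measurableX; exact: measurable_itv. Qed.

Let mPhi : measurable_fun [set: RR] Phi.
Proof.
apply/(measurable_restrictT _ mJJ); apply: measurable_funS (measurable_sqr_holo hh); last exact: box_disk2.
exact: measurable_disk2.
Qed.

Let Phi0 r : (0 <= Phi r)%E.
Proof. by apply: erestrict_ge0 => t _; rewrite lee_fin sqr_ge0. Qed.

Let Phi_le : (\int[(mu \x mu)%E]_r Phi r <= I)%E.
Proof.
rewrite -integral_mkcond; apply: ge0_subset_integral => //.
- exact: measurable_disk2.
- exact: measurable_sqr_holo.
- by move=> r _; rewrite lee_fin sqr_ge0.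
Qed.

Let integral_segint (g : R -> R) : {within J, continuous g} ->
  (\int[mu]_(t in J) (g t)%:E)%E = (segint g (- (1 / 2)) (1 / 2))%:E.
Proof.
move=> cg; rewrite /segint /Rintegral fineK//.
exact: (integrable_fin_num _ (integrable_segment cg)).
Qed.

(** Were [g t >= K] on the whole strip, the area integral would be at least [K * (b - a)]. The
    averaging over boxes takes this form: one good line is selected in each of four strips. *)
Let strip (G : R -> \bar R) (g : R -> R) a b K :
  (\int[mu]_t G t <= I)%E -> measurable_fun [set: measurableTypeR R] G ->
  (forall t, 0 <= G t)%E ->
  (forall t, - (1 / 2) <= t <= 1 / 2 -> G t = (g t)%:E) -> 0 <= K ->
  - (1 / 2) <= a -> a <= b -> b <= 1 / 2 ->
  (I < (K * (b - a))%:E)%E -> exists2 t, a <= t <= b & g t < K.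
Proof.
move=> GI mG G0 Gg K0 ha ab hb IK; apply: contrapT => nex.
have gK t : a <= t <= b -> K <= g t.
  by move=> tab; rewrite leNgt; apply/negP => ?; apply: nex; exists t.
suff : ((K * (b - a))%:E <= I)%E by rewrite leNgt IK.
apply: le_trans GI.
have <- : (\int[mu]_(t in `[a, b]) (cst K%:E t) = (K * (b - a))%:E)%E.
  rewrite integral_cst//= lebesgue_measure_itv/= lte_fin.
  by case: ltgtP ab => //= -> _; rewrite subrr mulr0 mule0.
apply: (@le_trans _ _ (\int[mu]_(t in `[a, b]) G t)%E).
  apply: ge0_le_integral => //.
  - by apply: measurable_funS mG.
  - move=> t /=; rewrite in_itv/= => tab; rewrite Gg; last by lra.
    by rewrite lee_fin gK.
by apply: ge0_subset_integral => //.
Qed.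

Let exists_V a b K : 0 <= K -> - (1 / 2) <= a -> a <= b -> b <= 1 / 2 ->
  (I < (K * (b - a))%:E)%E ->
  exists2 x, a <= x <= b & segint (F x) (- (1 / 2)) (1 / 2) < K.
Proof.
apply: (@strip (fubini_F mu Phi)).
- by rewrite -fubini_tonelli1.
- exact: measurable_fun_fubini_tonelli_F.
- by move=> t; apply: integral_ge0.
- move=> t ht; rewrite -integral_segint; last exact: cFy.
  rewrite [RHS]integral_mkcond; apply: eq_integral => y _.
  rewrite /Phi !patchE; congr (if _ then _ else _).
  by rewrite in_setX [t \in _]mem_set//= in_itv.
Qed.

Let exists_H a b K : 0 <= K -> - (1 / 2) <= a -> a <= b -> b <= 1 / 2 ->
  (I < (K * (b - a))%:E)%E ->
  exists2 y, a <= y <= b & segint (F ^~ y) (- (1 / 2)) (1 / 2) < K.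
Proof.
apply: (@strip (fubini_G mu Phi)).
- by rewrite -fubini_tonelli2.
- exact: measurable_fun_fubini_tonelli_G.
- by move=> t; apply: integral_ge0.
- move=> t ht; rewrite -integral_segint; last exact: cFx.
  rewrite [RHS]integral_mkcond; apply: eq_integral => y _.
  rewrite /Phi !patchE; congr (if _ then _ else _).
  by rewrite in_setX [t \in _]mem_set/= ?andbT// in_itv.
Qed.

Lemma deriv_l2_bound : h 0 = 0 -> ((cmod (dd h 0) ^+ 2 / 2048)%:E <= I)%E.
Proof.
move=> h0; set m := cmod (dd h 0).
have [m0|] := ltP 0 m; last first.
  move=> m0; have -> : m = 0 by apply/eqP; rewrite eq_le m0 cmod_ge0.
  by rewrite expr0n mul0r; apply: integral_ge0 => r _; rewrite lee_fin sqr_ge0.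
(* [512 = 128 * 4]: four lines with integral below [m ^+ 2 / 512] contradict [box_l2_bound]. The
   width 1/4 of the strips turns 512 into 2048. *)
have K0 : 0 <= m ^+ 2 / 512 by apply: divr_ge0; [exact: sqr_ge0|exact: ler0n].
rewrite leNgt; apply/negP => lt.
have ltI (d : R) : d = 1 / 4 -> (I < (m ^+ 2 / 512 * d)%:E)%E.
  by move=> ->; rewrite (_ : _ * _ = m ^+ 2 / 2048)//; lra.
have a1 : - (1 / 2) <= - (1 / 2) :> R by [].
have a2 : - (1 / 2) <= - (1 / 4) :> R by lra.
have a3 : - (1 / 4) <= 1 / 2 :> R by lra.
have a4 : - (1 / 4) - - (1 / 2) = 1 / 4 :> R by lra.
have b1 : - (1 / 2) <= 1 / 4 :> R by lra.
have b2 : 1 / 4 <= 1 / 2 :> R by lra.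
have b3 : 1 / 2 <= 1 / 2 :> R by [].
have b4 : 1 / 2 - 1 / 4 = 1 / 4 :> R by lra.
have [x1 hx1 V1] := exists_V K0 a1 a2 a3 (ltI _ a4).
have [x2 hx2 V2] := exists_V K0 b1 b2 b3 (ltI _ b4).
have [y1 hy1 H1] := exists_H K0 a1 a2 a3 (ltI _ a4).
have [y2 hy2 H2] := exists_H K0 b1 b2 b3 (ltI _ b4).
have := box_l2_bound hh h0 m0 hx1 hx2 hy1 hy2.
move: V1 V2 H1 H2; rewrite /F -/m.
repeat (move: (segint _ _ _) => ?); lra.
Qed.

End DerivL2.

(** * The derivative estimate in terms of the area norm *)

Section A2norm.
Variable R : realType.
Local Notation C := R[i].
Local Open Scope complex_scope.
Local Notation mu := (@lebesgue_measure R).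
Implicit Types (h : C -> C) (t : R).
Local Notation I h := (\int[(mu \x mu)%E]_(r in @disk2 R) ((cmod (h (r.1 +i* r.2)) ^+ 2)%:E))%E.

Let poweR_sqr t : 0 <= t -> ((t ^+ 2)%:E `^ 2^-1 = t%:E)%E.
Proof.
by move=> t0; rewrite poweR_EFin powR12_sqrt ?sqr_ge0// sqrtr_sqr ger0_norm.
Qed.

Let A2norm_arg_ge0 h : (0 <= (pi^-1)%:E * I h)%E.
Proof.
apply: mule_ge0; first by rewrite lee_fin invr_ge0 pi_ge0.
by apply: integral_ge0 => r _; rewrite lee_fin sqr_ge0.
Qed.

Lemma A2norm_ge0 h : (0 <= A2norm h)%E.
Proof. exact: poweR_ge0. Qed.

Lemma le_A2norm h t : 0 <= t -> ((t ^+ 2)%:E <= (pi^-1)%:E * I h)%E ->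
  (t%:E <= A2norm h)%E.
Proof.
move=> t0 th; rewrite -(poweR_sqr t0); apply: gt0_ler_poweR => //.
- by rewrite in_itv/= lee_fin sqr_ge0 leey.
- by rewrite in_itv/= A2norm_arg_ge0 leey.
Qed.

Lemma A2norm_le h t : 0 <= t -> ((pi^-1)%:E * I h <= (t ^+ 2)%:E)%E ->
  (A2norm h <= t%:E)%E.
Proof.
move=> t0 th; rewrite -(poweR_sqr t0); apply: gt0_ler_poweR => //.
- by rewrite in_itv/= A2norm_arg_ge0 leey.
- by rewrite in_itv/= lee_fin sqr_ge0 leey.
Qed.

Lemma dd_le_A2norm : exists2 K : R, 0 < K & forall h, holo h -> h 0 = 0 ->
  ((cmod (dd h 0))%:E <= K%:E * A2norm h)%E.
Proof.
have pi0 := @pi_gt0 R.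
have [c [c0 Hc]] : exists c : R, 0 < c /\ forall h, holo h -> h 0 = 0 ->
    ((cmod (dd h 0) ^+ 2 / c)%:E <= I h)%E.
  by exists 2048; split; [rewrite ltr0n|exact: deriv_l2_bound].
pose K := Num.sqrt (c * pi : R); have K0 : 0 < K by rewrite sqrtr_gt0 mulr_gt0.
exists K => // h hh h0; have m0 := cmod_ge0 (dd h 0); have := Hc h hh h0.
set m := cmod _ in m0 * => mI.
rewrite -lee_pdivrMl// -EFinM; apply: le_A2norm.
  by rewrite mulr_ge0// invr_ge0 ltW.
have -> : (K^-1 * m) ^+ 2 = pi^-1 * (m ^+ 2 / c).
  rewrite exprMn exprVn sqr_sqrtr; last by rewrite mulr_ge0 ?ltW.
  by rewrite invfM; ring.
by rewrite EFinM lee_wpmul2l// lee_fin invr_ge0 ltW.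
Qed.

End A2norm.

(** * Logarithmic weights are square integrable *)

Section DiskWeight.
Variable R : realType.
Local Notation mu := (@lebesgue_measure R).
Local Notation RR := (measurableTypeR R * measurableTypeR R)%type.
Implicit Types x y c : R.

Lemma continuous_inv_sqrt (T : topologicalType) (f : T -> R) (t : T) : 0 < f t ->
  {for t, continuous f} -> {for t, continuous (fun s => (Num.sqrt (f s))^-1)}.
Proof.
move=> f0 cf; apply: cvgV; first by rewrite gt_eqF// sqrtr_gt0.
apply: (continuous_comp cf); exact: sqrt_continuous.
Qed.

Lemma is_derive_asin_scale c y : 0 < c -> - c < y < c ->
  is_derive y 1 (fun t => asin (t / c)) (Num.sqrt (c ^+ 2 - y ^+ 2))^-1.
Proof.
move=> c0 yc.
have y1 : -1 < y / c < 1 by rewrite ltr_pdivlMr// ltr_pdivrMr//; lra.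
have da := is_derive1_asin y1.
have db : is_derive y 1 (fun t => t / c) c^-1.
  have -> : (fun t => t / c) = c^-1 \*: (id : R -> R) by apply/funext => t /=; rewrite mulrC.
  by apply: is_derive_eq; rewrite [LHS]mulr1.
have := @is_derive1_comp R asin (fun t => t / c) y _ _ da db; congr is_derive.
rewrite -invfM -{2}(ger0_norm (ltW c0)) -sqrtr_sqr -sqrtrM; last first.
  by move: (y / c) y1 => e /andP[? ?]; nra.
congr (Num.sqrt _)^-1; field; by rewrite gt_eqF.
Qed.

Lemma integral_inv_sqrt_segment c d : 0 < d -> d < c ->
  (\int[mu]_(y in `[(- d)%R, d]) ((Num.sqrt (c ^+ 2 - y ^+ 2))^-1)%:E <= pi%:E)%E.
Proof.
move=> d0 dc; have c0 : 0 < c by lra.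
have cf y : - d <= y <= d -> {for y, continuous (fun t : R => (Num.sqrt (c ^+ 2 - t ^+ 2))^-1)}.
  move=> yd; apply: continuous_inv_sqrt; first by nra.
  by apply: cvgB; [exact: cvg_cst|rewrite !expr2; apply: cvgM].
have dF y : - d <= y <= d -> is_derive y 1 (fun t => asin (t / c)) (Num.sqrt (c ^+ 2 - y ^+ 2))^-1.
  by move=> yd; apply: is_derive_asin_scale => //; lra.
have cF y : - d <= y <= d -> {for y, continuous (fun t : R => asin (t / c))}.
  by move=> /dF[+ _] => /derivable1_diffP/differentiable_continuous.
rewrite (@continuous_FTC2 _ _ (fun t => asin (t / c))).
- have r1 : -1 <= d / c <= 1 by rewrite ler_pdivlMr// ler_pdivrMr//; lra.
  have r2 : -1 <= - d / c <= 1 by rewrite ler_pdivlMr// ler_pdivrMr//; lra.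
  rewrite -EFinB lee_fin; have := asin_lepi2 r1; have := asin_geNpi2 r2; lra.
- lra.
- by apply: continuous_in_subspaceT => y; rewrite inE/= in_itv/= => /cf.
- split.
  + by move=> y; rewrite in_itv/= => yd; have [] := dF y ltac:(lra).
  + by apply: cvg_at_right_filter; apply: cF; lra.
  + by apply: cvg_at_left_filter; apply: cF; lra.
- by move=> y; rewrite in_itv/= => yd; rewrite derive1E; have [] := dF y ltac:(lra).
Qed.

(** The integrand blows up at both ends, so the arcsine primitive is used on closed subintervals,
    and monotone convergence gives the open interval. *)
Lemma integral_inv_sqrt c : 0 < c ->
  (\int[mu]_(y in `](- c)%R, c[) ((Num.sqrt (c ^+ 2 - y ^+ 2))^-1)%:E <= pi%:E)%E.
Proof.
(* With [n.+1] in place of [n.+2], [d 0] would vanish, while [integral_inv_sqrt_segment] wants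
   [0 < d]. *)
move=> c0; pose d n : R := c * (1 - n.+2%:R^-1).
have hd n : 0 < d n < c.
  have h1 : (n.+2%:R : R)^-1 < 1 by rewrite invf_lt1// ltr1n.
  have h2 : 0 < (n.+2%:R : R)^-1 by rewrite invr_gt0.
  by rewrite /d; move: _^-1 h1 h2 => e *; apply/andP; split; nra.
pose A n : set (measurableTypeR R) := `[- d n, d n]%classic.
have -> : `]-c, c[%classic = \bigcup_n A n.
  apply/seteqP; split => [y|y [n _]]; rewrite /A/= !in_itv/=; last by have := hd n; lra.
  move=> yc; have y0 : 0 < 1 - `|y| / c.
    by rewrite subr_gt0 ltr_pdivrMr// mul1r ltr_norml.
  have [n Hn] : exists n : nat, (1 - `|y| / c)^-1 < n%:R.
    by exists (Num.bound (1 - `|y| / c)^-1); apply: archi_boundP; rewrite invr_ge0 ltW.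
  exists n => //=; rewrite in_itv/= -ler_norml /d.
  have h1 : (n.+2%:R : R)^-1 <= 1 - `|y| / c.
    rewrite -[leRHS]invrK lef_pV2 ?posrE ?invr_gt0//.
    by apply: ltW; apply: (lt_le_trans Hn); rewrite ler_nat ltnW// ltnW.
  have -> : `|y| = c * (`|y| / c) by field; rewrite gt_eqF.
  by rewrite (ler_pM2l c0) lerBrDl -lerBrDr.
have cvg := @ge0_nondecreasing_set_cvg_integral _ _ R A
  (fun y => ((Num.sqrt (c ^+ 2 - y ^+ 2))^-1)%:E) mu.
have {}cvg := cvg _ _ _ _.
have nd : nondecreasing_seq A.
  apply/nondecreasing_seqP => n; rewrite subsetEset; apply: subset_itv; rewrite bnd_simp ?lerN2 /d.
    by rewrite ler_pM2l// lerB// lef_pV2 ?posrE// ler_nat.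
  by rewrite ler_pM2l// lerB// lef_pV2 ?posrE// ler_nat.
have mA n : measurable (A n) by exact: measurable_itv.
have mf n : measurable_fun (A n) (fun y => ((Num.sqrt (c ^+ 2 - y ^+ 2))^-1)%:E).
  apply/measurable_EFinP; apply: (@measurable_funS _ _ _ _ `]-c, c[%classic) => //.
    by apply: subset_itv; rewrite bnd_simp; have := hd n; lra.
  apply: open_continuous_measurable_fun; first exact: interval_open.
  move=> y; rewrite inE/= in_itv/= => yd.
  suff : {for (y : R), continuous (fun t : R => (Num.sqrt (c ^+ 2 - t ^+ 2))^-1)} by [].
  apply: continuous_inv_sqrt; first by nra.
  by apply: cvgB; [exact: cvg_cst|rewrite !expr2; apply: cvgM].
have f0 n x : A n x -> (0 <= ((Num.sqrt (c ^+ 2 - x ^+ 2))^-1)%:E)%E.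
  by move=> _; rewrite lee_fin invr_ge0 sqrtr_ge0.
have {}cvg := cvg nd mA mf f0.
rewrite -(cvg_lim _ cvg)//; apply: lime_le; first by apply/cvg_ex; eexists; exact: cvg.
by near=> n; apply: integral_inv_sqrt_segment; have /andP[] := hd n.
Unshelve. all: by end_near. Qed.

Local Notation w := (fun r : RR => ((Num.sqrt (1 - r.1 ^+ 2 - r.2 ^+ 2))^-1)%:E).

Lemma measurable_disk_weight : measurable_fun (@disk2 R : set RR) w.
Proof.
apply/measurable_EFinP.
apply: (continuous_measurable_plane (f := fun r => (Num.sqrt (1 - r.1 ^+ 2 - r.2 ^+ 2))^-1) (@open_disk2 R)).
move=> [x y]; rewrite /disk2/= => xy; apply: continuous_inv_sqrt; first by rewrite /=; lra.
apply: cvgB; [apply: cvgB; first exact: cvg_cst|]; rewrite !expr2; apply: cvgM;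
  (exact: cvg_fst || exact: cvg_snd).
Qed.

(** For fixed [x] the section is [integral_inv_sqrt] with [c = sqrt (1 - x^2)], at most pi whatever
    [x] is, and [x] ranges over an interval of length 2. *)
Lemma integral_disk_weight :
  (\int[(mu \x mu)%E]_(r in @disk2 R) w r <= (pi * 2)%:E)%E.
Proof.
have mW := (measurable_restrictT _ (@measurable_disk2 R)).1 measurable_disk_weight.
set W := w \_ _ in mW.
have W0 r : (0 <= W r)%E.
  by apply: erestrict_ge0 => t _; rewrite lee_fin invr_ge0 sqrtr_ge0.
rewrite integral_mkcond -/W fubini_tonelli1//.
pose B : set (measurableTypeR R) := `]-1, 1[%classic.
have mB : measurable B by exact: measurable_itv.
apply: (@le_trans _ _ (\int[mu]_(x in B) (cst pi%:E x))%E); last first.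
  rewrite integral_cst//= /B lebesgue_measure_itv/= lte_fin.
  have -> : (-1 < 1 :> R) = true by apply/idP; lra.
  by rewrite -EFinD -EFinM lee_fin opprK.
rewrite [leRHS]integral_mkcond; apply: ge0_le_integral => //.
- by move=> x _; apply: integral_ge0.
- exact: measurable_fun_fubini_tonelli_F.
- by apply/(measurable_restrictT _ mB); exact: measurable_cst.
move=> x _; rewrite /fubini_F; have [xB|xB] := pselect (-1 < x < 1).
  rewrite patchE mem_set; last by rewrite /B/= in_itv.
  pose c := Num.sqrt (1 - x ^+ 2).
  have x1 : 0 < 1 - x ^+ 2 by nra.
  have c0 : 0 < c by rewrite sqrtr_gt0.
  have c2 : c ^+ 2 = 1 - x ^+ 2 by rewrite sqr_sqrtr// ltW.
  apply: le_trans (integral_inv_sqrt c0); rewrite [leRHS]integral_mkcond.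
  rewrite le_eqVlt; apply/orP; left; apply/eqP/eq_integral => y _.
  rewrite /W !patchE c2; congr (if _ then _ else _).
  have E : (x ^+ 2 + y ^+ 2 < 1) = (- c < y < c).
    rewrite -ltr_norml -[`|y| < c]ltr_sqr ?nnegrE ?normr_ge0 ?(ltW c0)//.
    by rewrite real_normK ?num_real// c2; apply/idP/idP; lra.
  by apply/idP/idP; rewrite !in_setE /disk2/= in_itv/= E.
rewrite patchE memNset; last by rewrite /B/= in_itv.
rewrite integral0_eq// => y _; rewrite /W patchE ifF//.
apply/negP; rewrite in_setE /disk2/= => xy; apply: xB; nra.
Qed.

(* [1 + ln (1 / t) <= 8 t^(-1/8)], raised to the fourth power. *)
Lemma ln_pow4_le (t : R) : 0 < t -> t <= 1 ->
  (1 - ln t) ^+ 4 <= 8 ^+ 4 / Num.sqrt t.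
Proof.
move=> t0 t1; pose a := Num.sqrt t; pose b := Num.sqrt a; pose s := Num.sqrt b.
have a0 : 0 < a by rewrite sqrtr_gt0.
have b0 : 0 < b by rewrite sqrtr_gt0.
have s0 : 0 < s by rewrite sqrtr_gt0.
have sb : s ^+ 2 = b by rewrite sqr_sqrtr// ltW.
have ba : b ^+ 2 = a by rewrite sqr_sqrtr// ltW.
have at' : a ^+ 2 = t by rewrite sqr_sqrtr// ltW.
have s4 : s ^+ 4 = a by rewrite -[4%N]/(2 * 2)%N exprM sb ba.
have lt : ln t = 8 * ln s.
  by rewrite -at' -s4 -exprM lnXn// mulr_natl.
have ls : - ln s <= s^-1 - 1.
  rewrite -lnV ?posrE// -{1}[s^-1](subrKC 1) le_ln1Dx//.
  by rewrite ltrBrDl subrr invr_gt0.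
have ln0 : 0 <= 1 - ln t by have := ln_le0 t1; lra.
rewrite -/a -s4 -expr_div_n ler_pXn2r// ?nnegrE//; last by rewrite divr_ge0// ltW.
by rewrite lt; lra.
Qed.

End DiskWeight.

(** * Area norm of functions of logarithmic growth *)

Section A2bound.
Variable R : realType.
Local Notation C := R[i].
Local Open Scope complex_scope.
Local Notation mu := (@lebesgue_measure R).
Local Notation RR := (measurableTypeR R * measurableTypeR R)%type.

(** The integral of 1 / (1 - r) for r from 0 to |z|: what a derivative of size 1 / (1 - r)
    accumulates along a radius. *)
Definition hlog (z : C) : R := - ln (1 - cmod z).

Lemma hlog_ge0 z : 0 <= hlog z.
Proof. by rewrite oppr_ge0 ln_le0// gerBl cmod_ge0. Qed.

(** Squaring yields the fourth power of [1 - ln (1 - |z|)], at most [c / sqrt (1 - |z|)] by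
    [ln_pow4_le]. This is dominated by the disk weight, at the cost of a factor 2, because
    [1 - |z|^2 <= 4 (1 - |z|)]. *)
Lemma A2norm_le_hlog : exists2 K : R, 0 < K & forall (f : C -> C) (B : R),
  holo f -> 0 <= B -> (forall z, disk z -> cmod (f z) <= B * (1 + hlog z) ^+ 2) ->
  (A2norm f <= (K * B)%:E)%E.
Proof.
have pi0 := @pi_gt0 R.
have [c [c0 Hc]] : exists c : R, 0 < c /\ forall t : R, 0 < t -> t <= 1 ->
    (1 - ln t) ^+ 4 <= c / Num.sqrt t.
  by exists (8 ^+ 4); split; [rewrite exprn_gt0|exact: ln_pow4_le].
pose K := Num.sqrt (c * 4); have K0 : 0 < K by rewrite sqrtr_gt0 mulr_gt0.
exists K => // f B hf B0 Hf; apply: A2norm_le; first by rewrite mulr_ge0// ltW.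
have -> : (K * B) ^+ 2 = pi^-1 * ((B ^+ 2 * (c * 2)) * (pi * 2)).
  rewrite exprMn sqr_sqrtr; last by rewrite mulr_ge0// ltW.
  have E (P : R) : 0 < P -> c * 4 * B ^+ 2 = P^-1 * (B ^+ 2 * (c * 2) * (P * 2)).
    by move=> P0; field; rewrite gt_eqF.
  exact: E.
rewrite EFinM; apply: lee_wpmul2l; first by rewrite lee_fin invr_ge0 ltW.
rewrite EFinM; have Bc : 0 <= B ^+ 2 * (c * 2).
  by rewrite mulr_ge0 ?sqr_ge0// mulr_ge0// ltW.
apply: le_trans (lee_wpmul2l _ (integral_disk_weight R)); last by rewrite lee_fin.
rewrite -ge0_integralZl//; last 2 first.
- exact: measurable_disk2.
- exact: measurable_disk_weight.
apply: ge0_le_integral.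
- exact: measurable_disk2.
- by move=> r _; rewrite lee_fin sqr_ge0.
- exact: measurable_sqr_holo.
- by apply: measurable_funeM; exact: measurable_disk_weight.
move=> [x y] /disk2_disk dz; rewrite -EFinM lee_fin /=.
set z := x +i* y in dz *; have z1 : cmod z < 1 := dz; have z0 := cmod_ge0 z.
have t0 : 0 < 1 - cmod z by lra.
have fz := Hf z dz; rewrite /hlog in fz.
have q0 : 0 < 1 - cmod z ^+ 2 by nra.
have -> : 1 - x ^+ 2 - y ^+ 2 = 1 - cmod z ^+ 2 by rewrite sqr_cmod/=; lra.
apply: (@le_trans _ _ (B ^+ 2 * (1 - ln (1 - cmod z)) ^+ 4)).
  rewrite -[4%N]/(2 * 2)%N exprM -exprMn ler_pXn2r// ?nnegrE ?cmod_ge0//.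
  by rewrite mulr_ge0// sqr_ge0.
rewrite -[leRHS]mulrA ler_wpM2l ?sqr_ge0//; apply: (le_trans (Hc _ t0 _)); first by lra.
move: (cmod z) z0 z1 t0 q0 {fz} => r r0 r1 t0 q0.
rewrite -[leRHS]mulrA ler_pM2l// -[leLHS]div1r ler_pdivrMr ?sqrtr_gt0// mulrAC ler_pdivlMr ?sqrtr_gt0// mul1r.
rewrite -ler_sqr ?nnegrE ?mulr_ge0 ?sqrtr_ge0// exprMn.
by rewrite !sqr_sqrtr; [nra|exact: ltW|exact: ltW].
Qed.

End A2bound.

(** * Disk automorphisms and growth along radii *)

Section Sigma.
Variable R : realType.
Local Notation C := R[i].
Local Open Scope complex_scope.
Implicit Types a z w : C.

Lemma sqr_cmod_lt1 z : disk z -> 0 < 1 - cmod z ^+ 2.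
Proof. by rewrite /disk/= => z1; have := cmod_ge0 z; nra. Qed.

Lemma sigma_den_neq0 a z : disk a -> disk z -> 1 - a^* * z != 0.
Proof.
rewrite /disk/= => a1 z1; rewrite -cmod_gt0.
apply: lt_le_trans (cmodBl _ _); rewrite cmod1 cmodM cmodJ subr_gt0.
by have := cmod_ge0 a; have := cmod_ge0 z; nra.
Qed.

(** The polynomial identity behind the invariance of the disk under [sigma a] and behind equality in
    Schwarz-Pick for [sigma a]. *)
Lemma sqr_cmod_den a z : cmod (1 - a^* * z) ^+ 2 - cmod (a - z) ^+ 2 =
  (1 - cmod a ^+ 2) * (1 - cmod z ^+ 2).
Proof. by rewrite !sqr_cmod; case: a => a b; case: z => x y /=; ring. Qed.

Lemma one_sub_sqr_sigma a z : disk a -> disk z ->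
  1 - cmod (sigma a z) ^+ 2 =
  (1 - cmod a ^+ 2) * (1 - cmod z ^+ 2) / cmod (1 - a^* * z) ^+ 2.
Proof.
move=> da dz; rewrite /sigma cmodM cmodV -sqr_cmod_den expr_div_n mulrBl divff//.
by rewrite expf_neq0// cmod_eq0 sigma_den_neq0.
Qed.

Lemma disk_sigma a z : disk a -> disk z -> disk (sigma a z).
Proof.
move=> da dz; have : 0 < 1 - cmod (sigma a z) ^+ 2.
  have d0 : 0 < cmod (1 - a^* * z) by rewrite cmod_gt0 sigma_den_neq0.
  by rewrite one_sub_sqr_sigma// divr_gt0 ?mulr_gt0 ?exprn_gt0 ?sqr_cmod_lt1.
by rewrite /disk/= => h; have := cmod_ge0 (sigma a z); nra.
Qed.

Lemma disk0 : disk (0 : C).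
Proof. by rewrite /disk/= cmod0. Qed.

Lemma sigma0 a : sigma a 0 = a.
Proof. by rewrite /sigma mulr0 !subr0 divr1. Qed.

Lemma sigma_self a : sigma a a = 0.
Proof. by rewrite /sigma subrr mul0r. Qed.

Definition dsigma a z : C := - (1 - cmod a ^+ 2)%:C / (1 - a^* * z) ^+ 2.

Lemma cder_sigma a z : disk a -> disk z -> cder (sigma a) z (dsigma a z).
Proof.
move=> da dz; have n0 := sigma_den_neq0 da dz.
have dnum : cder (fun w => a - w) z (0 - 1) by apply: cderB; [exact: cder_cst|exact: cder_id].
have dden : cder (fun w => 1 - a^* * w) z (0 - (a^* * 1 + z * 0)).
  by apply: cderB; [exact: cder_cst|apply: cderM; [exact: cder_cst|exact: cder_id]].
apply: cder_eq (cderM dnum (cderV (f := fun w => 1 - a^* * w) n0 dden)) _.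
have e : (1 - cmod a ^+ 2)%:C = 1 - a * a^* by rewrite -sqr_cmodC rmorphB rmorph1.
rewrite /dsigma e.
by field.
Qed.

Lemma cmod_dsigma a z : disk a -> disk z ->
  (1 - cmod z ^+ 2) * cmod (dsigma a z) = 1 - cmod (sigma a z) ^+ 2.
Proof.
move=> da dz; rewrite one_sub_sqr_sigma// /dsigma [cmod (_ / _)]cmodM cmodV cmodX cmodN cmod_real.
by rewrite gtr0_norm ?sqr_cmod_lt1// mulrA [X in X / _]mulrC.
Qed.

Lemma cder_comp_sigma f a z : holo f -> disk a -> disk z ->
  cder (fun w => f (sigma a w)) z (dd f (sigma a z) * dsigma a z).
Proof.
move=> hf da dz; apply: cder_comp; first exact: cder_sigma.
by apply: holo_cder => //; exact: disk_sigma.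
Qed.

Lemma holo_comp_sigma f a : holo f -> disk a -> holo (fun w => f (sigma a w)).
Proof. by move=> hf da; apply: cder_holo => z; exact: cder_comp_sigma. Qed.

(** Automorphism invariance of the Bloch seminorm, pointwise: it moves estimates at [a] to the
    origin. *)
Lemma dd_comp_sigma f a z : holo f -> disk a -> disk z ->
  (1 - cmod z ^+ 2) * cmod (dd (fun w => f (sigma a w)) z) =
  (1 - cmod (sigma a z) ^+ 2) * cmod (dd f (sigma a z)).
Proof.
move=> hf da dz; rewrite (cder_dd (cder_comp_sigma hf da dz)) cmodM.
by rewrite mulrCA cmod_dsigma// mulrC.
Qed.

Lemma selfmap_sigma a : disk a -> selfmap (sigma a).
Proof.
move=> da; split; last by move=> z; exact: disk_sigma.
by apply: cder_holo => z; exact: cder_sigma.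
Qed.

Lemma selfmap_comp f g : selfmap f -> selfmap g -> selfmap (fun w => f (g w)).
Proof.
move=> [hf sf] [hg sg]; split; last by move=> z /sg /sf.
apply: (@cder_holo _ _ (fun z => dd f (g z) * dd g z)) => z dz.
by apply: cder_comp; apply: holo_cder => //; exact: sg.
Qed.

End Sigma.

(** * Integration of derivative bounds along radii *)

Section Rays.
Variable R : realType.
Local Notation C := R[i].
Local Open Scope complex_scope.

Lemma is_derive_of_lin (f : R -> R) (t l : R) : (forall e, 0 < e -> exists2 d, 0 < d &
    forall s, `|s - t| < d -> `|f s - f t - l * (s - t)| <= e * `|s - t|) ->
  is_derive t 1 f l.
Proof.
move=> H.
have ql : (fun h : R => h^-1 *: ((f \o shift t) (h *: (1 : R)) - f t)) @ (0 : R)^' --> l.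
  apply/cvgrPdist_le => /= e e0; have [d d0 Hd] := H _ e0.
  rewrite near_withinE; apply/nbhs_ballP; exists d => //= h.
  rewrite /ball/= sub0r normrN => hd h0.
  have := Hd (h + t); rewrite addrK => /(_ hd) K.
  rewrite -(ler_pM2r (_ : 0 < `|h|)) ?normr_gt0// -normrM; apply: le_trans K.
  rewrite distrC mulrBl -[_ *: _]/(_ * _) -[(h *: 1)]/(h * 1) mulr1 mulrAC mulVf//.
  by rewrite mul1r.
by split; [apply/cvg_ex; exists l|exact: cvg_lim].
Qed.

Lemma is_derive_ray (f : C -> C) (z : C) (t : R) l : cder f (t%:C * z) l ->
  is_derive t 1 (fun s : R => complex.Re (f (s%:C * z))) (complex.Re (l * z)) /\
  is_derive t 1 (fun s : R => complex.Im (f (s%:C * z))) (complex.Im (l * z)).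
Proof.
move=> /cderP H.
have z0 := cmod_ge0 z; have z1 : 0 < 1 + cmod z by lra.
suff H' e : 0 < e -> exists2 d, 0 < d & forall s : R, `|s - t| < d ->
    cmod (f (s%:C * z) - f (t%:C * z) - (s - t)%:C * (l * z)) <= e * `|s - t|.
  split; apply: is_derive_of_lin => e /H'[d d0 Hd]; exists d => // s /Hd; apply: le_trans.
    apply: le_trans (Re_le_cmod _); rewrite !ReB [complex.Re (_%:C * _)]ReM/= mul0r subr0.
    by rewrite [complex.Re (l * z) * _]mulrC.
  apply: le_trans (Im_le_cmod _); rewrite !ImB [complex.Im (_%:C * _)]ImM/= mul0r addr0.
  by rewrite [complex.Im (l * z) * _]mulrC.
move=> e0; have [d d0 Hd] := H _ (divr_gt0 e0 z1).
exists (d / (1 + cmod z)); first exact: divr_gt0.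
move=> s; rewrite ltr_pdivlMr// => sd.
have eq : s%:C * z - t%:C * z = (s - t)%:C * z by rewrite rmorphB mulrBl.
have := Hd (s%:C * z); rewrite eq cmodM cmod_real mulrCA.
have n0 := normr_ge0 (s - t).
have lt : `|s - t| * cmod z < d by apply: le_lt_trans sd; nra.
move=> /(_ lt) /le_trans; apply; rewrite mulrCA mulrAC mulrC ler_wpM2r//.
by rewrite ler_pdivrMr//; nra.
Qed.

Lemma increment_le (f g f' g' : R -> R) :
  (forall t : R, 0 <= t <= 1 -> is_derive t 1 f (f' t)) ->
  (forall t : R, 0 <= t <= 1 -> is_derive t 1 g (g' t)) ->
  (forall t : R, 0 <= t <= 1 -> f' t <= g' t) -> f 1 - f 0 <= g 1 - g 0.
Proof.
move=> df dg fg.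
have dh (t : R) : 0 <= t <= 1 -> is_derive t 1 (g \- f) (g' t - f' t).
  by move=> t01; apply: is_deriveB; [exact: dg|exact: df].
have [||t t01] := @MVT R (g \- f) (fun t => g' t - f' t) 0 1 ltr01.
- by move=> t; rewrite in_itv/= => t01; apply: dh; lra.
- apply: derivable_within_continuous => t; rewrite in_itv/= => t01.
  by have [] := dh t t01.
rewrite /= subr0 mulr1; rewrite in_itv/= in t01.
have := fg t ltac:(lra); lra.
Qed.

Lemma disk_ray (z : C) (t : R) : disk z -> 0 <= t <= 1 -> disk (t%:C * z).
Proof.
rewrite /disk/= => z1 t01; rewrite cmodM cmod_real ger0_norm; last lra.
have := cmod_ge0 z; nra.
Qed.

Lemma is_derive_hlog (z : C) (t : R) : disk z -> 0 <= t <= 1 ->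
  is_derive t 1 (fun s : R => - ln (1 - s * cmod z)) (cmod z / (1 - t * cmod z)).
Proof.
rewrite /disk/= => z1 t01; have z0 := cmod_ge0 z.
have p : 0 < 1 - t * cmod z by nra.
have d1 : is_derive t 1 (fun s : R => 1 - s * cmod z) (0 - cmod z).
  apply: is_deriveB.
  have -> : (fun s : R => s * cmod z) = cmod z \*: (id : R -> R).
    by apply/funext => s /=; rewrite mulrC.
  by apply: is_derive_eq; rewrite [LHS]mulr1.
have d2 := @is_derive1_comp R (@ln R) (fun s => 1 - s * cmod z) t _ _ (is_derive1_ln p) d1.
by have := is_deriveN d2; congr is_derive; rewrite sub0r mulrN opprK mulrC.
Qed.

Lemma hlog_ray (z : C) (t : R) : 0 <= t -> hlog (t%:C * z) = - ln (1 - t * cmod z).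
Proof. by move=> t0; rewrite /hlog cmodM cmod_real ger0_norm. Qed.

(** The majorant is an antiderivative: with [L] the value of [hlog] along the ray,
    [A * L + B / 2 * L ^+ 2] has derivative [(A + B * L) * L']. The case [B = 0] is the growth of
    Bloch functions; [beta_le] needs [B > 0] in general. *)
Lemma growth (f : C -> C) (A B : R) z : holo f -> disk z -> 0 <= A -> 0 <= B ->
  (forall w, disk w -> (1 - cmod w) * cmod (dd f w) <= A + B * hlog w) ->
  cmod (f z - f 0) <= A * hlog z + B / 2 * hlog z ^+ 2.
Proof.
move=> hf dz A0 B0 H; have z1 : cmod z < 1 := dz; have z0 := cmod_ge0 z.
have [->|d0] := eqVneq (f z - f 0) 0.
  by rewrite cmod0 addr_ge0// mulr_ge0 ?hlog_ge0 ?divr_ge0 ?sqr_ge0.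
(* This rotation makes the increment real and positive, so that comparing real parts along the ray
   is enough. *)
set d := f z - f 0 in d0 *; pose u := d^* / (cmod d)%:C.
have cd0 : 0 < cmod d by rewrite cmod_gt0.
have ud : u * d = (cmod d)%:C.
  have cdn0 : (cmod d)%:C != 0 :> C by rewrite -cmod_eq0 cmod_real gtr0_norm// gt_eqF.
  by apply: (mulfI cdn0); rewrite /u mulrA mulrCA mulfV// mulr1 mulrC -sqr_cmodC rmorphXn expr2.
have cu : cmod u = 1 by rewrite /u cmodM cmodV cmodJ cmod_real gtr0_norm// divff// gt_eqF.
pose L (t : R) : R := - ln (1 - t * cmod z).
have dL (t : R) : 0 <= t <= 1 -> is_derive t 1 L (cmod z / (1 - t * cmod z)).
  exact: is_derive_hlog.
pose G t : R := A * L t + B / 2 * L t ^+ 2.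
have dG (t : R) : 0 <= t <= 1 -> is_derive t 1 G ((A + B * L t) * (cmod z / (1 - t * cmod z))).
  move=> /dL dLt.
  have d1 := is_deriveZ A dLt; have d2 := is_deriveZ (B / 2) (is_deriveX 2 dLt).
  have := is_deriveD d1 d2; congr is_derive.
  have E (k l : R) : A * k + B / 2 * (2 * l * k) = (A + B * l) * k by field.
  exact: E.
pose F (t : R) : R := complex.Re (u * f (t%:C * z)).
have dF (t : R) : 0 <= t <= 1 -> is_derive t 1 F (complex.Re (u * dd f (t%:C * z) * z)).
  move=> t01; have dtz := disk_ray dz t01.
  have := cderM (cder_cst u (t%:C * z)) (holo_cder hf dtz).
  by rewrite mulr0 addr0 => /is_derive_ray[].
have L0 : L 0 = 0 by rewrite /L mul0r subr0 ln1 oppr0.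
have L1 : L 1 = hlog z by rewrite /L mul1r.
have F10 : F 1 - F 0 = cmod d.
  by rewrite /F rmorph1 rmorph0 mul1r mul0r -ReB -mulrBr ud.
have := increment_le dF dG; rewrite F10 /G L0 L1 expr0n/= !mulr0 addr0 subr0.
apply => t t01.
have dtz := disk_ray dz t01; have t0 : 0 <= t by lra.
have p : 0 < 1 - t * cmod z by nra.
apply: le_trans (le_trans (ler_norm _) (Re_le_cmod _)) _.
rewrite [cmod (_ * z)]cmodM [cmod (u * _)]cmodM cu mul1r mulrA ler_pdivlMr// mulrAC.
apply: ler_wpM2r => //; have := H _ dtz.
by rewrite hlog_ray// cmodM cmod_real ger0_norm// mulrC.
Qed.

(* The Schwarz-Pick inequality up to the constant [K], integrated along the
   segment from [0] to [z]. *)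
Lemma growth_log_dist (f : C -> C) (K : R) z : selfmap f -> disk z ->
  (forall w, disk w -> (1 - cmod w) * cmod (dd f w) <= K * (1 - cmod (f w) ^+ 2)) ->
  ln (1 - cmod (f z) ^+ 2) - ln (1 - cmod (f 0) ^+ 2) <= 2 * K * hlog z.
Proof.
move=> [hf sf] dz H; have z1 : cmod z < 1 := dz; have z0 := cmod_ge0 z.
pose x (t : R) : R := complex.Re (f (t%:C * z)).
pose y (t : R) : R := complex.Im (f (t%:C * z)).
pose N (t : R) : R := 1 - (x t ^+ 2 + y t ^+ 2).
have NE t : N t = 1 - cmod (f (t%:C * z)) ^+ 2 by rewrite /N sqr_cmod.
pose x' (t : R) : R := complex.Re (dd f (t%:C * z) * z).
pose y' (t : R) : R := complex.Im (dd f (t%:C * z) * z).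
have dN (t : R) : 0 <= t <= 1 -> is_derive t 1 N (- (2 * (x t * x' t + y t * y' t))).
  move=> t01; have dtz := disk_ray dz t01.
  have [dx dy] := is_derive_ray (holo_cder hf dtz).
  have d2 := is_deriveD (is_deriveX 2 dx) (is_deriveX 2 dy).
  have := is_deriveB (is_derive_cst (1 : R) t 1) d2; congr is_derive.
  have E (a b c d : R) : 0 - (2 * a * b + 2 * c * d) = - (2 * (a * b + c * d)) by ring.
  exact: E.
have N0 (t : R) : 0 <= t <= 1 -> 0 < N t.
  by move=> t01; rewrite NE sqr_cmod_lt1//; apply: sf; exact: disk_ray.
have dF (t : R) : 0 <= t <= 1 -> is_derive t 1 (fun s => ln (N s))
    ((N t)^-1 * - (2 * (x t * x' t + y t * y' t))).
  by move=> t01; exact: is_derive1_comp (is_derive1_ln (N0 t t01)) (dN t t01).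
pose G (t : R) : R := 2 * K * - ln (1 - t * cmod z).
have dG (t : R) : 0 <= t <= 1 -> is_derive t 1 G (2 * K * (cmod z / (1 - t * cmod z))).
  by move=> t01; have d1 := is_deriveZ (2 * K) (is_derive_hlog dz t01); exact: d1.
have G0 : G 0 = 0 by rewrite /G mul0r subr0 ln1 oppr0 mulr0.
have G1 : G 1 = 2 * K * hlog z by rewrite /G mul1r.
have := increment_le dF dG.
rewrite G0 G1 subr0 !NE rmorph0 rmorph1 mul0r mul1r; apply => t t01.
have dtz := disk_ray dz t01; have t0 : 0 <= t by lra.
have p : 0 < 1 - t * cmod z by nra.
have Nt := N0 t t01; have ft : cmod (f (t%:C * z)) < 1 := sf _ dtz.
have := H _ dtz; rewrite -NE cmodM cmod_real ger0_norm//.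
set g := f (t%:C * z) in ft *; set g' := dd f (t%:C * z) => Ht.
have RJ (v w : C) : complex.Re v * complex.Re w + complex.Im v * complex.Im w =
    complex.Re (v^* * w) by case: v => ? ?; case: w => ? ? /=; ring.
have E : x t * x' t + y t * y' t = complex.Re (g^* * (g' * z)) := RJ g (g' * z).
have g'0 := cmod_ge0 g'; have g0 := cmod_ge0 g.
have := Re_le_cmod (g^* * (g' * z)); rewrite !cmodM cmodJ -E ler_norml => /andP[+ _].
move: (x t * x' t + y t * y' t) => e {E} le.
have le' : - e <= cmod g' * cmod z.
  have : cmod g * (cmod g' * cmod z) <= cmod g' * cmod z.
    by apply: ler_piMl; [exact: mulr_ge0|exact: ltW].
  lra.
have h1 := ler_wpM2r (ltW p) le'; have h2 := ler_wpM2r z0 Ht.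
rewrite [leLHS]mulrC ler_pdivrMr// mulrA mulrAC ler_pdivlMr//.
by move: (1 - t * cmod z) h1 h2 {p Ht} => q h1 h2; lra.
Qed.

End Rays.

(** * Test functions and the Schwarz-Pick inequality *)

Section TestFunctions.
Variable R : realType.
Local Notation C := R[i].
Local Open Scope complex_scope.

Lemma cderX (f : C -> C) z l n : cder f z l ->
  cder (fun w => f w ^+ n.+1) z (n.+1%:R * f z ^+ n * l).
Proof.
move=> dfz; elim: n => [|n ih]; first by rewrite expr0 mulr1 mul1r.
apply: cder_eq (cderM dfz ih) _.
by rewrite [n.+2%:R]mulrS exprS; ring.
Qed.

(** Taylor polynomials of log (1 / (1 - c z)): holomorphic without the choice of a branch, and with
    a geometric sum as derivative. *)
Definition logsum (c : C) (n : nat) (z : C) : C :=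
  \sum_(k < n) (c * z) ^+ k.+1 / k.+1%:R.

Lemma cder_logsum c n z : cder (logsum c n) z (c * \sum_(k < n) (c * z) ^+ k).
Proof.
have dc : cder (fun w => c * w) z c.
  by apply: cder_eq (cderM (cder_cst c z) (cder_id z)) _; rewrite mulr1 mulr0 addr0.
elim: n => [|n ih].
  rewrite big_ord0 mulr0 (_ : logsum c 0 = fun=> 0); first exact: cder_cst.
  by apply/funext => w; rewrite /logsum big_ord0.
have n0 : n.+1%:R != 0 :> C by rewrite pnatr_eq0.
rewrite (_ : logsum c n.+1 = fun w => logsum c n w + (c * w) ^+ n.+1 * n.+1%:R^-1); last first.
  by apply/funext => w; rewrite /logsum big_ord_recr.
apply: cder_eq (cderD ih (cderM (cderX n dc) (cder_cst _ z))) _.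
by rewrite big_ord_recr /= mulr0 add0r mulrDr; congr (_ + _); field.
Qed.

Lemma holo_logsum c n : holo (logsum c n).
Proof. by apply: cder_holo => z _; exact: cder_logsum. Qed.

(** The sum is (1 - q^n) / (1 - q). Uniformity in [n] is the point: it lets the degree of the test
    function depend on the point where it is evaluated. *)
Lemma cmod_geometric (q : C) n (r : R) : cmod q <= r -> r < 1 ->
  (1 - r) * cmod (\sum_(k < n) q ^+ k) <= 2.
Proof.
move=> qr r1; have q0 := cmod_ge0 q; set S := \sum_(k < n) _.
have : cmod (1 - q) * cmod S <= 2.
  rewrite -cmodM -opprB mulNr -subrX1 cmodN; apply: le_trans (cmodB _ _) _.
  by rewrite cmod1 cmodX -[leRHS]/(1 + 1) lerD2r exprn_ile1//; lra.
have := cmodBl 1 q; rewrite cmod1 => h1; apply: le_trans.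
by rewrite ler_wpM2r ?cmod_ge0//; lra.
Qed.

Lemma logsum_real (x : R) n : logsum x%:C n 1 = (\sum_(k < n) x ^+ k.+1 / k.+1%:R)%:C.
Proof.
rewrite /logsum mulr1 rmorph_sum; apply: eq_bigr => k _.
by rewrite rmorphM/= fmorphV rmorphXn rmorph_nat.
Qed.

(** The degree is taken with [x ^+ n <= 1 - x]. The differentiated series then has remainder x (x
    t)^n / (1 - x t) at most 1 on [[0, 1]], and integrating it costs the summand 1. *)
Lemma logsum_ge (x : R) : 0 <= x -> x < 1 ->
  exists n, - ln (1 - x) <= 1 + \sum_(k < n) x ^+ k.+1 / k.+1%:R.
Proof.
move=> x0 x1; have x1' : 0 < 1 - x by lra.
have [n Hn] : exists n : nat, x ^+ n <= 1 - x.
  have nx : `|x| < 1 by rewrite ger0_norm.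
  have /cvgrPdist_lt/(_ _ x1') := @cvg_geometric R 1 x nx.
  move=> [n _ /(_ n (leqnn n))]; rewrite sub0r normrN /= /geometric/= mul1r => h.
  by exists n; apply: ltW; apply: le_lt_trans h; exact: ler_norm.
exists n.
pose G (t : R) : R := complex.Re (logsum x%:C n (t%:C * 1)) + t.
have dG (t : R) : 0 <= t <= 1 ->
    is_derive t 1 G (x * \sum_(k < n) (x * t) ^+ k + 1).
  move=> t01; have [dR _] := is_derive_ray (cder_logsum x%:C n (t%:C * 1)).
  have := is_deriveD dR (is_derive_id t 1); congr is_derive.
  rewrite !mulr1; congr (_ + _); rewrite -rmorphM.
  have -> : \sum_(k < n) (x * t)%:C ^+ k = (\sum_(k < n) (x * t) ^+ k)%:C.
    by rewrite rmorph_sum; apply: eq_bigr => k _; rewrite rmorphXn.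
  by rewrite -rmorphM.
have dx : disk (x%:C : C) by rewrite /disk/= cmod_real ger0_norm.
have cx : cmod (x%:C : C) = x by rewrite cmod_real ger0_norm.
have dF (t : R) : 0 <= t <= 1 ->
    is_derive t 1 (fun s : R => - ln (1 - s * x)) (x / (1 - t * x)).
  by move=> /(is_derive_hlog dx); rewrite cx.
have G1 : G 1 = \sum_(k < n) x ^+ k.+1 / k.+1%:R + 1.
  by rewrite /G rmorph1 mulr1 logsum_real.
have G0 : G 0 = 0.
  rewrite /G rmorph0 mul0r addr0 /logsum big1// => k _.
  by rewrite mulr0 expr0n mul0r.
have := increment_le dF dG; rewrite G1 G0 mul0r mul1r subr0 ln1 oppr0 !addr0 subr0.
rewrite [leRHS]addrC; apply => t t01.
have p : 0 < 1 - t * x by nra.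
rewrite ler_pdivrMr// -subr_ge0.
have -> : (x * \sum_(k < n) (x * t) ^+ k + 1) * (1 - t * x) - x =
    1 - t * x - x * (x * t) ^+ n.
  have := subrX1 (x * t) n; set S := \sum_(k < n) _ => e.
  have -> : (x * t) ^+ n = 1 + (x * t - 1) * S by rewrite -e; ring.
  ring.
have h1 : (x * t) ^+ n <= x ^+ n.
  by apply: lerXn2r; rewrite ?nnegrE//; nra.
have h2 : 0 <= (x * t) ^+ n by rewrite exprn_ge0//; nra.
nra.
Qed.

End TestFunctions.

(** * The Bloch norm and the use of test functions *)

Section Bloch.
Variable R : realType.
Local Notation C := R[i].
Local Open Scope complex_scope.

Lemma bloch_norm_le (f : C -> C) (A B : R) : cmod (f 0) <= A ->
  (forall z, disk z -> (1 - cmod z ^+ 2) * cmod (dd f z) <= B) ->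
  (bloch_norm f <= (A + B)%:E)%E.
Proof.
move=> fA fB; rewrite /bloch_norm EFinD; apply: leeD; first by rewrite lee_fin.
by apply: ge_ereal_sup => _ [z dz <-]; rewrite lee_fin fB.
Qed.

Lemma bloch_semi_ge (f : C -> C) z : disk z ->
  (((1 - cmod z ^+ 2) * cmod (dd f z))%:E <= bloch_semi f)%E.
Proof. by move=> dz; apply: ereal_sup_ubound; exists z. Qed.

Lemma bloch_semi_ge0 (f : C -> C) : (0 <= bloch_semi f)%E.
Proof.
apply: le_trans (bloch_semi_ge f (disk0 R)); rewrite lee_fin cmod0 expr0n subr0 mul1r.
exact: cmod_ge0.
Qed.

Lemma bloch_norm_ge0 (f : C -> C) : (0 <= bloch_norm f)%E.
Proof. by apply: adde_ge0; [rewrite lee_fin cmod_ge0|exact: bloch_semi_ge0]. Qed.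

Lemma bloch_normP (f : C -> C) (r : R) : (bloch_norm f <= r%:E)%E ->
  cmod (f 0) <= r /\
  forall z, disk z -> (1 - cmod z ^+ 2) * cmod (dd f z) <= r.
Proof.
move=> fr; split=> [|z dz]; rewrite -lee_fin; apply: le_trans fr.
  by rewrite /bloch_norm leeDl// bloch_semi_ge0.
apply: (le_trans (bloch_semi_ge f dz)).
by rewrite /bloch_norm leeDr// lee_fin cmod_ge0.
Qed.

Lemma cder_wcomp (u phi f : C -> C) z : holo u -> selfmap phi -> holo f -> disk z ->
  cder (wcomp u phi f) z (u z * (dd f (phi z) * dd phi z) + f (phi z) * dd u z).
Proof.
move=> hu [hp sp] hf dz; apply: cderM; first exact: holo_cder.
by apply: cder_comp; apply: holo_cder => //; exact: sp.
Qed.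

Lemma holo_wcomp (u phi f : C -> C) : holo u -> selfmap phi -> holo f ->
  holo (wcomp u phi f).
Proof. by move=> hu hp hf; apply: cder_holo => z; exact: cder_wcomp. Qed.

(** [opnorm] is a supremum over the unit ball, so [f] is divided by [A + B], which bounds its Bloch
    norm, and the factor returns in the conclusion. *)
Lemma opnorm_test (u phi f : C -> C) (M A B : R) : holo u -> selfmap phi -> holo f ->
  (opnorm u phi <= M%:E)%E -> 0 < A + B -> cmod (f 0) <= A ->
  (forall z, disk z -> (1 - cmod z ^+ 2) * cmod (dd f z) <= B) ->
  cmod (u 0) * cmod (f (phi 0)) <= (A + B) * M /\
  forall z, disk z ->
    (1 - cmod z ^+ 2) * cmod (dd (wcomp u phi f) z) <= (A + B) * M.
Proof.
move=> hu hp hf uM; set r := A + B => r0 fA fB.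
pose c : C := (r^-1)%:C.
have cc : cmod c = r^-1 by rewrite cmod_real ger0_norm// invr_ge0 ltW.
pose g z := c * f z.
have dg z : disk z -> cder g z (c * dd f z).
  move=> dz; apply: cder_eq (cderM (cder_cst c z) (holo_cder hf dz)) _.
  by rewrite mulr0 addr0.
have hg : holo g := cder_holo dg.
have g1 : (bloch_norm g <= 1)%E.
  have -> : 1%E = (r^-1 * A + r^-1 * B)%:E by rewrite -mulrDr mulVf// gt_eqF.
  apply: bloch_norm_le => [|z dz]; first by rewrite cmodM cc ler_wpM2l ?invr_ge0 ?(ltW r0).
  by rewrite (cder_dd (dg z dz)) cmodM cc mulrCA ler_wpM2l ?invr_ge0 ?(ltW r0)// fB.
have /bloch_normP[w0 wd] : (bloch_norm (wcomp u phi g) <= M%:E)%E.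
  by apply: le_trans uM; apply: ereal_sup_ubound; exists g.
split=> [|z dz].
  move: w0; rewrite /wcomp /g !cmodM cc mulrCA -ler_pdivlMl ?invr_gt0// invrK; exact.
have := wd z dz.
have dw := cder_wcomp hu hp hg dz; have [hp' sp] := hp.
rewrite (cder_dd dw) (cder_dd (cder_wcomp hu hp hf dz)) (cder_dd (dg _ (sp _ dz))).
have -> : u z * (c * dd f (phi z) * dd phi z) + g (phi z) * dd u z =
    c * (u z * (dd f (phi z) * dd phi z) + f (phi z) * dd u z).
  have E (k v1 v2 v3 v4 v5 : C) :
      v1 * (k * v2 * v3) + k * v4 * v5 = k * (v1 * (v2 * v3) + v4 * v5) by ring.
  exact: E.
by rewrite cmodM cc mulrCA -ler_pdivlMl ?invr_gt0// invrK.
Qed.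

End Bloch.

(** * Comparison of logarithms and hyperbolic derivatives *)

Section Main.
Variable R : realType.
Local Notation C := R[i].
Local Open Scope complex_scope.

Lemma onem_cmod_le (w : C) : disk w -> 1 - cmod w <= 1 - cmod w ^+ 2.
Proof. by rewrite /disk/= => w1; have := cmod_ge0 w; nra. Qed.

Lemma logterm_split (w : C) : disk w ->
  logterm w = ln 2 - ln (1 - cmod w ^+ 2).
Proof. by move=> dw; rewrite /logterm ln_div ?posrE ?sqr_cmod_lt1. Qed.

Lemma ln2_gt0 : 0 < ln (2 : R).
Proof. by apply: ln_gt0; lra. Qed.

Lemma ln2_le1 : ln (2 : R) <= 1.
Proof. by have := @le_ln1Dx R 1 ltac:(lra); congr (ln _ <= _); lra. Qed.

Lemma logterm_ge (w : C) : disk w -> ln 2 <= logterm w.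
Proof.
move=> dw; rewrite logterm_split// lerDl oppr_ge0 ln_le0//.
by rewrite gerBl sqr_ge0.
Qed.

(** The 2 inside [logterm] absorbs the factor [1 + |w|] of [1 - |w|^2]. *)
Lemma hlog_le_logterm (w : C) : disk w -> hlog w <= logterm w.
Proof.
move=> dw; have w1 : cmod w < 1 := dw; have w0 := cmod_ge0 w.
rewrite /hlog -lnV ?posrE ?subr_gt0// /logterm ler_ln ?posrE ?invr_gt0 ?subr_gt0//; last first.
  by rewrite divr_gt0// sqr_cmod_lt1.
rewrite ler_pdivlMr ?sqr_cmod_lt1// mulrC ler_pdivrMr ?subr_gt0//.
by nra.
Qed.

Lemma bloch_growth (f : C -> C) (B : R) z : holo f -> disk z -> 0 <= B ->
  (forall w, disk w -> (1 - cmod w ^+ 2) * cmod (dd f w) <= B) ->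
  cmod (f z - f 0) <= B * hlog z.
Proof.
move=> hf dz B0 H; have := @growth R f B 0 z hf dz B0 (lexx 0).
rewrite mul0r mul0r addr0; apply => w dw; rewrite mul0r addr0.
apply: le_trans (H w dw); apply: ler_wpM2r; first exact: cmod_ge0.
exact: onem_cmod_le.
Qed.

Lemma bloch_growth_sigma (f : C -> C) (B : R) a z : holo f -> disk a -> disk z -> 0 <= B ->
  (forall w, disk w -> (1 - cmod w ^+ 2) * cmod (dd f w) <= B) ->
  cmod (f (sigma a z) - f a) <= B * hlog z.
Proof.
move=> hf da dz B0 H.
have := @bloch_growth (fun w => f (sigma a w)) B z (holo_comp_sigma hf da) dz B0.
rewrite sigma0; apply => w dw; rewrite dd_comp_sigma//.
by apply: H; exact: disk_sigma.
Qed.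

(** The function whose area norm enters [alpha]: [phi] moved by automorphisms so that it fixes 0. *)
Definition normalized (phi : C -> C) (a z : C) : C := sigma (phi a) (phi (sigma a z)).

Lemma selfmap_normalized phi a : selfmap phi -> disk a -> selfmap (normalized phi a).
Proof.
move=> sp da; apply: selfmap_comp; first by apply: selfmap_sigma; exact: sp.2.
by apply: selfmap_comp => //; exact: selfmap_sigma.
Qed.

Lemma normalized0 phi a : normalized phi a 0 = 0.
Proof. by rewrite /normalized sigma0 sigma_self. Qed.

(** The modulus of the derivative of [normalized phi a] at 0 is the hyperbolic derivative of [phi]
    at [a]. *)
Lemma dd_normalized phi a : selfmap phi -> disk a ->
  (1 - cmod (phi a) ^+ 2) * cmod (dd (normalized phi a) 0) =
  (1 - cmod a ^+ 2) * cmod (dd phi a).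
Proof.
move=> [hp sp] da; have dpa := sp _ da.
have d1 := cder_comp_sigma hp da (disk0 R); rewrite sigma0 in d1.
have d2 : cder (sigma (phi a)) (phi (sigma a 0)) (dsigma (phi a) (phi a)).
  by rewrite sigma0; exact: cder_sigma.
rewrite (cder_dd (cder_comp (g := fun w => phi (sigma a w)) d1 d2)).
have := cmod_dsigma da (disk0 R); have := cmod_dsigma dpa dpa.
rewrite sigma0 sigma_self cmod0 expr0n subr0 mul1r.
move: (dsigma _ _) (dsigma _ _) => s1 s2 e1 e2.
by rewrite [cmod (s2 * _)]cmodM mulrA e1 mul1r cmodM e2 mulrC.
Qed.

(* Schwarz-Pick with a non-sharp constant: the derivative estimate [dd_le_A2norm]
   applied to a self-map of the disk. *)
Lemma schwarz_pick_weak : exists2 K : R, 0 < K & forall phi : C -> C, selfmap phi ->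
  forall w, disk w -> (1 - cmod w) * cmod (dd phi w) <= K * (1 - cmod (phi w) ^+ 2).
Proof.
have [K1 K10 H1] := dd_le_A2norm R; have [K2 K20 H2] := A2norm_le_hlog R.
exists (K1 * K2); first exact: mulr_gt0.
move=> phi sp w dw; have [hn sn] := selfmap_normalized sp dw.
have h1 : cmod (dd (normalized phi w) 0) <= K1 * K2.
  rewrite -lee_fin; apply: (le_trans (H1 _ hn (normalized0 phi w))).
  rewrite EFinM; apply: lee_wpmul2l; first by rewrite lee_fin ltW.
  rewrite -[K2]mulr1; apply: H2 => // z dz; rewrite mul1r.
  apply: (@le_trans _ _ 1); first by apply: ltW; exact: sn.
  by rewrite exprn_ege1// lerDl hlog_ge0.
have h2 := dd_normalized sp dw; have p0 := sqr_cmod_lt1 (sp.2 _ dw).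
apply: (@le_trans _ _ ((1 - cmod w ^+ 2) * cmod (dd phi w))).
  apply: ler_wpM2r; first exact: cmod_ge0.
  exact: onem_cmod_le.
by rewrite -h2 mulrC; apply: ler_wpM2r; [exact: ltW|exact: h1].
Qed.

(** [growth_log_dist] bounds the difference of the logarithms; [logterm >= ln 2] turns this into a
    factor. The product form is wanted because [du_bound] multiplies the derivative of [u] by the
    logarithm. *)
Lemma logterm_sigma : exists2 K : R, 0 <= K & forall (phi : C -> C) a z,
  selfmap phi -> disk a -> disk z ->
  logterm (phi a) <= logterm (phi (sigma a z)) * (1 + K * hlog z).
Proof.
have [K K0 HK] := schwarz_pick_weak; have l0 := ln2_gt0.
exists (2 * K / ln 2); first by rewrite divr_ge0 ?ltW// mulr_gt0.
move=> phi a z sp da dz; have sps := selfmap_comp sp (selfmap_sigma da).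
have := growth_log_dist sps dz (HK _ sps); rewrite sigma0.
have dpa := sp.2 _ da; have dps := sps.2 _ dz.
have := logterm_ge dps; rewrite (logterm_split dpa).
have hz := hlog_ge0 z; set L := logterm (phi (sigma a z)) => L2 h.
have e : L = ln 2 - ln (1 - cmod (phi (sigma a z)) ^+ 2) by rewrite -logterm_split.
have : 2 * K * hlog z <= L * (2 * K / ln 2 * hlog z).
  have -> : L * (2 * K / ln 2 * hlog z) = L / ln 2 * (2 * K * hlog z) by ring.
  rewrite ler_peMl ?mulr_ge0 ?(ltW K0)// ler_pdivlMr// mul1r.
  exact: L2.
by move: h; rewrite mulrDr mulr1 e; lra.
Qed.

End Main.

(** * The two bounds *)

Local Opaque dd cmod.

(** * Lower bound for the operator norm *)

Section LowerBound.
Variable R : realType.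
Local Notation C := R[i].
Local Open Scope complex_scope.

(** With coefficient [b^*] the value at [b] is real, a partial sum for -ln (1 - |b|^2). The 2 is
    [ln 2 <= 1] plus the truncation error 1; the 4 is [1 + |z| <= 2] times the bound of
    [cmod_geometric]. *)
Lemma log_test (b : C) : disk b -> exists f : C -> C, [/\ holo f, f 0 = 0,
  forall z, disk z -> (1 - cmod z ^+ 2) * cmod (dd f z) <= 4 &
  logterm b <= 2 + cmod (f b)].
Proof.
move=> db; have b1 : cmod b < 1 := db; have b0 := cmod_ge0 b.
have x1 : cmod b ^+ 2 < 1 by have := sqr_cmod_lt1 db; lra.
have [n Hn] := logsum_ge (sqr_ge0 (cmod b)) x1.
exists (logsum b^* n); split.
- exact: holo_logsum.
- by rewrite /logsum big1// => k _; rewrite mulr0 expr0n mul0r.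
- move=> z dz; rewrite (cder_dd (cder_logsum b^* n z)) cmodM cmodJ.
  have z1 : cmod z < 1 := dz; have z0 := cmod_ge0 z.
  have qz : cmod (b^* * z) <= cmod z by rewrite cmodM cmodJ; nra.
  have := cmod_geometric n qz z1; set S := \sum_(k < n) _.
  have := cmod_ge0 S; move: (cmod S) => s s0 h.
  have h2 : (1 - cmod z ^+ 2) * s <= 4.
    have -> : (1 - cmod z ^+ 2) * s = (1 + cmod z) * ((1 - cmod z) * s) by ring.
    by nra.
  by rewrite mulrCA; have := sqr_cmod_lt1 dz; nra.
- have -> : logsum b^* n b = logsum (cmod b ^+ 2)%:C n 1.
    by rewrite /logsum sqr_cmodC mulr1 mulrC.
  rewrite logsum_real cmod_real logterm_split//.
  apply: le_trans (_ : _ <= 2 + \sum_(k < n) (cmod b ^+ 2) ^+ k.+1 / k.+1%:R) _.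
    by have := @ln2_le1 R; lra.
  by rewrite lerD2l ler_norm.
Qed.

Variables (u phi : C -> C) (M : R).
Hypotheses (hu : holo u) (sp : selfmap phi) (uM : (opnorm u phi <= M%:E)%E).

Let test_one : cmod (u 0) <= M /\
  forall z, disk z -> (1 - cmod z ^+ 2) * cmod (dd u z) <= M.
Proof.
have h1 : holo (fun=> 1 : C) by apply: (@cder_holo _ _ (fun=> 0)) => z _; exact: cder_cst.
have d1 z : dd (fun=> 1 : C) z = 0 by apply: cder_dd; exact: cder_cst.
have [||z dz|t0 t1] := opnorm_test (A := 1) (B := 0) hu sp h1 uM.
- by rewrite addr0.
- by rewrite cmod1.
- by rewrite d1 cmod0 mulr0.
rewrite cmod1 mulr1 addr0 mul1r in t0; rewrite addr0 mul1r in t1.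
split=> [|z dz]; first exact: t0.
have := t1 z dz; rewrite (cder_dd (cder_wcomp hu sp h1 dz)) d1.
by rewrite mul0r mulr0 add0r mul1r.
Qed.

Let M0 : 0 <= M.
Proof. exact: le_trans (cmod_ge0 _) test_one.1. Qed.

Let test_sigma b z : disk b -> disk z ->
  (1 - cmod z ^+ 2) * cmod (dd (wcomp u phi (sigma b)) z) <= 2 * M.
Proof.
move=> db dz; have [hs ss] := selfmap_sigma db.
have [||w dw|_ H] := opnorm_test (A := 1) (B := 1) hu sp hs uM.
- by [].
- by rewrite sigma0; apply: ltW; exact: db.
- by rewrite (cder_dd (cder_sigma db dw)) cmod_dsigma// gerBl sqr_ge0.
exact: H.
Qed.

(** The test function [sigma (phi a)] vanishes at [phi a], which kills the term with the derivative
    of [u], and its own derivative there has modulus 1 / (1 - |phi a|^2). *)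
Let dphi_bound a : disk a ->
  (1 - cmod a ^+ 2) * (cmod (u a) * cmod (dd phi a)) <= 2 * M * (1 - cmod (phi a) ^+ 2).
Proof.
move=> da; have db := sp.2 _ da; have := test_sigma db da.
rewrite (cder_dd (cder_wcomp hu sp (selfmap_sigma db).1 da)) sigma_self mul0r addr0.
rewrite (cder_dd (cder_sigma db db)); have := cmod_dsigma db db.
rewrite sigma_self cmod0 expr0n subr0.
move: (dsigma _ _) => s e H.
have := ler_wpM2r (ltW (sqr_cmod_lt1 db)) H; apply: le_trans.
rewrite !cmodM le_eqVlt; apply/orP; left; apply/eqP.
have E (P Q U S W : R) : P * (U * (S * W)) * Q = P * (U * W) * (Q * S) by ring.
by rewrite E e mulr1.
Qed.

(** [6 = 2 + 4]: the 2 of [log_test] with the constant test function, and the norm 4 of the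
    logarithmic one. *)
Lemma u0_bound : cmod (u 0) * logterm (phi 0) <= 6 * M.
Proof.
have db := sp.2 _ (disk0 R); have [f [hf f0 f4 fl]] := log_test db.
have [||//|t0 _] := opnorm_test (A := 0) (B := 4) hu sp hf uM.
- by rewrite add0r.
- by rewrite f0 cmod0.
rewrite add0r in t0; have := ler_wpM2l (cmod_ge0 (u 0)) fl.
have := test_one.1; lra.
Qed.

(** In the derivative of the image of the logarithmic test function, the term with the derivative of
    [phi] is removed by [dphi_bound]. The constant is [2 + 4 + 2 * 4]: the 2 of [log_test], the norm
    of [f], and the removed term. *)
Let du_bound a : disk a ->
  (1 - cmod a ^+ 2) * cmod (dd u a) * logterm (phi a) <= 14 * M.
Proof.
move=> da; have db := sp.2 _ da; have [f [hf f0 f4 fl]] := log_test db.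
have [||//|_ t1] := opnorm_test (A := 0) (B := 4) hu sp hf uM.
- by rewrite add0r.
- by rewrite f0 cmod0.
have {t1} := t1 a da; rewrite (cder_dd (cder_wcomp hu sp hf da)) add0r => t1.
have := dphi_bound da; have := f4 _ db; have := test_one.2 a da.
have := cmodBl (f (phi a) * dd u a) (- (u a * (dd f (phi a) * dd phi a))).
rewrite cmodN opprK [_ + u a * _]addrC !cmodM.
have p := sqr_cmod_lt1 da; have pb := sqr_cmod_lt1 db.
move: (1 - cmod a ^+ 2) p t1 => P p t1.
move: (1 - cmod (phi a) ^+ 2) pb => Q pb.
move: (cmod (_ + _)) t1 => D t1.
have := cmod_ge0 (dd f (phi a)); have := cmod_ge0 (dd u a).
move: fl; generalize (cmod (dd f (phi a))) (cmod (dd u a)) (cmod (f (phi a))).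
generalize (cmod (u a)) (cmod (dd phi a)) => U Ph F' U' F fl U0 F0 h1 h2 h3 h4.
have e1 : P * U' * logterm (phi a) <= P * U' * (2 + F).
  by apply: ler_wpM2l => //; rewrite mulr_ge0// ltW.
have e2 : P * (F * U') <= P * D + P * (U * (F' * Ph)).
  by rewrite -mulrDr ler_pM2l//; lra.
have e3 : P * (U * (F' * Ph)) <= 2 * M * (Q * F').
  by have := ler_wpM2r F0 h4; lra.
have e4 : 2 * M * (Q * F') <= 2 * M * 4.
  by apply: ler_wpM2l => //; rewrite mulr_ge0.
lra.
Qed.

(** [u a * normalized phi a z] is the image of [sigma (phi a)] at [sigma a z], which vanishes at
    [z = 0], minus [u (sigma a z) - u a] times a factor of modulus below 1. Bloch growth bounds them
    by [2 * M * hlog z] and [M * hlog z]. The bound on [normalized] divides by [|u a|], so [u a = 0]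
    is treated apart. *)
Lemma alpha_le (K : R) : 0 < K -> (forall (f : C -> C) (B : R), holo f -> 0 <= B ->
    (forall z, disk z -> cmod (f z) <= B * (1 + hlog z) ^+ 2) ->
    (A2norm f <= (K * B)%:E)%E) ->
  forall a, disk a -> (alpha u phi a <= (3 * K * M)%:E)%E.
Proof.
move=> K0 HK a da; have db := sp.2 _ da; rewrite /alpha.
have [->|ua0] := eqVneq (u a) 0.
  by rewrite cmod0 mul0e lee_fin !mulr_ge0// ltW.
have ca : 0 < cmod (u a) by rewrite cmod_gt0.
have [hn sn] := selfmap_normalized sp da.
suff H : (A2norm (normalized phi a) <= (K * (3 * M / cmod (u a)))%:E)%E.
  apply: (le_trans (lee_wpmul2l _ H)); first by rewrite lee_fin ltW.
  rewrite -EFinM lee_fin le_eqVlt; apply/orP; left; apply/eqP; field.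
  by rewrite gt_eqF.
apply: HK => // [|z dz]; first by rewrite divr_ge0 ?mulr_ge0// ltW.
have hl := hlog_ge0 z.
apply: (@le_trans _ _ (3 * M / cmod (u a) * hlog z)); last first.
  by apply: ler_wpM2l; [rewrite divr_ge0 ?mulr_ge0// ltW|nra].
rewrite mulrAC ler_pdivlMr//.
have g1 := bloch_growth_sigma hu da dz M0 test_one.2.
have hG := holo_wcomp hu sp (selfmap_sigma db).1.
have M20 : 0 <= 2 * M by rewrite mulr_ge0.
have := bloch_growth_sigma hG da dz M20 (fun w => test_sigma db (z := w)).
rewrite {2}/wcomp sigma_self mulr0 subr0 /wcomp -/(normalized phi a z) cmodM => g2.
have := cmodBl (u a) (u (sigma a z)); rewrite (cmodBC (u a)) => g3.
have s1 : cmod (normalized phi a z) < 1 := sn _ dz.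
have s0 := cmod_ge0 (normalized phi a z).
have d0 := cmod_ge0 (u (sigma a z) - u a).
move: (cmod (normalized _ _ _)) (cmod (u (sigma a z) - _)) s0 s1 d0 g1 g2 g3 => s d s0 s1 d0 g1 g2 g3.
have e1 := ler_wpM2l s0 g3; have e2 := ler_piMl d0 (ltW s1).
rewrite mulrBr in e1; lra.
Qed.

(** [du_bound] at [sigma a w] carries the logarithm at [phi (sigma a w)]; [HK'] replaces it by [L]
    at the cost of [1 + K' * hlog w]. This is the hypothesis of [growth] with constants [A] and
    [A * K']. *)
Lemma beta_le (K K' : R) : 0 < K -> 0 <= K' ->
  (forall (f : C -> C) (B : R), holo f -> 0 <= B ->
    (forall z, disk z -> cmod (f z) <= B * (1 + hlog z) ^+ 2) ->
    (A2norm f <= (K * B)%:E)%E) ->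
  (forall (phi : C -> C) a z, selfmap phi -> disk a -> disk z ->
    logterm (phi a) <= logterm (phi (sigma a z)) * (1 + K' * hlog z)) ->
  forall a, disk a -> (beta u phi a <= (14 * K * (1 + K') * M)%:E)%E.
Proof.
move=> K0 K'0 HK HK' a da; have db := sp.2 _ da; rewrite /beta.
set L := logterm (phi a).
have l2 := @ln2_gt0 R.
have L0 : 0 < L by apply: lt_le_trans l2 (logterm_ge db).
have hus := holo_comp_sigma hu da.
pose A := 14 * M / L; have A0 : 0 <= A by rewrite divr_ge0 ?mulr_ge0// ltW.
suff H : (A2norm (fun z => (u (sigma a z) - u a)%R) <= (K * (A * (1 + K')))%:E)%E.
  apply: (le_trans (lee_wpmul2l _ H)); first by rewrite lee_fin ltW.
  rewrite -EFinM lee_fin le_eqVlt; apply/orP; left; apply/eqP; rewrite /A; field.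
  by rewrite gt_eqF.
apply: HK.
- apply: (@cder_holo _ _ (fun w => dd u (sigma a w) * dsigma a w - 0)) => w dw.
  by apply: cderB; [exact: cder_comp_sigma|exact: cder_cst].
- by rewrite mulr_ge0// addr_ge0.
move=> z dz; have hl := hlog_ge0 z.
have AK0 : 0 <= A * K' by rewrite mulr_ge0.
have := growth hus dz A0 AK0; rewrite sigma0 => g.
apply: le_trans (g _) _.
  move=> w dw; have dsw := disk_sigma da dw; have dps := sp.2 _ dsw.
  have Lw : 0 < logterm (phi (sigma a w)) by apply: lt_le_trans l2 (logterm_ge dps).
  apply: (@le_trans _ _ ((1 - cmod w ^+ 2) * cmod (dd (fun w => u (sigma a w)) w))).
    by apply: ler_wpM2r; [exact: cmod_ge0|exact: onem_cmod_le].
  rewrite dd_comp_sigma//; have h1 := du_bound dsw; have h2 := HK' phi a w sp da dw.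
  set D := _ * cmod _ in h1 *.
  have D0 : 0 <= D by rewrite mulr_ge0 ?cmod_ge0// ltW// sqr_cmod_lt1.
  have -> : A + A * K' * hlog w = 14 * M * (1 + K' * hlog w) / L.
    by rewrite /A; field; rewrite gt_eqF.
  rewrite ler_pdivlMr//; apply: (le_trans (ler_wpM2l D0 h2)).
  rewrite mulrA; apply: ler_wpM2r => //.
  by rewrite addr_ge0// mulr_ge0// hlog_ge0.
have -> : A * (1 + K') * (1 + hlog z) ^+ 2 =
    A * hlog z + A * K' / 2 * hlog z ^+ 2 + (A * (1 + hlog z + hlog z ^+ 2) +
      A * K' * (1 + 2 * hlog z + hlog z ^+ 2 / 2)) by field.
rewrite lerDl addr_ge0// mulr_ge0// !addr_ge0// ?sqr_ge0 ?mulr_ge0// divr_ge0 ?sqr_ge0//.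
Qed.

End LowerBound.

(** * Upper bound for the operator norm *)

Section UpperBound.
Variable R : realType.
Local Notation C := R[i].
Local Open Scope complex_scope.
Variables (u phi : C -> C) (K : R).
Hypotheses (hu : holo u) (sp : selfmap phi) (K0 : 0 < K).
Hypothesis HK : forall h : C -> C, holo h -> h 0 = 0 ->
  ((cmod (dd h 0))%:E <= K%:E * A2norm h)%E.

(** From [|f w| <= 1 + hlog w], with [hlog w <= logterm w] and [1 <= logterm w / ln 2]. *)
Let Lc : R := 1 + (ln 2)^-1.

Let growth_logterm (f : C -> C) w : holo f -> (bloch_norm f <= 1)%E -> disk w ->
  cmod (f w) <= Lc * logterm w.
Proof.
move=> hf /(bloch_normP (r := 1))[f0 f1] dw.
have := bloch_growth hf dw ler01 f1; rewrite mul1r.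
have := cmodD (f w - f 0) (f 0); rewrite subrK.
have := hlog_le_logterm dw; have := logterm_ge dw; have l0 := @ln2_gt0 R.
set L := logterm w => l1 h1 h2 h3.
have : 1 <= (ln 2)^-1 * L by rewrite mulrC ler_pdivlMr// mul1r.
rewrite /Lc; lra.
Qed.

Lemma alpha_ge a : disk a ->
  ((cmod (u a) * ((1 - cmod a ^+ 2) * cmod (dd phi a) / (1 - cmod (phi a) ^+ 2)))%:E
   <= K%:E * alpha u phi a)%E.
Proof.
move=> da; have [hn _] := selfmap_normalized sp da.
have p := sqr_cmod_lt1 (sp.2 _ da).
rewrite -dd_normalized// mulrAC mulfV ?mul1r ?gt_eqF// EFinM muleCA.
apply: lee_wpmul2l; first by rewrite lee_fin cmod_ge0.
exact: HK hn (normalized0 phi a).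
Qed.

Lemma beta_ge a : disk a ->
  ((logterm (phi a) * ((1 - cmod a ^+ 2) * cmod (dd u a)))%:E <= K%:E * beta u phi a)%E.
Proof.
move=> da; have db := sp.2 _ da; rewrite EFinM muleCA.
apply: lee_wpmul2l; first by rewrite lee_fin ltW// (lt_le_trans (@ln2_gt0 R))// logterm_ge.
pose v z := u (sigma a z) - u a.
have dv z : disk z -> cder v z (dd u (sigma a z) * dsigma a z - 0).
  by move=> dz; apply: cderB; [exact: cder_comp_sigma|exact: cder_cst].
have := HK (cder_holo dv); rewrite {1}/v sigma0 subrr => /(_ erefl).
apply: le_trans; rewrite lee_fin (cder_dd (dv _ (disk0 R))) subr0 sigma0 cmodM.
have := cmod_dsigma da (disk0 R); rewrite sigma0 cmod0 expr0n subr0 mul1r => ->.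
by rewrite mulrC.
Qed.

Lemma opnorm_le : (opnorm u phi <= (Lc * (1 + K))%:E * rhs u phi)%E.
Proof.
have l0 := @ln2_gt0 R; have Lc0 : 0 < Lc by rewrite ltr_wpDr// invr_ge0 ltW.
have Lc1 : 1 <= Lc by rewrite lerDl invr_ge0 ltW.
(* One constant for the three summands of [rhs], which need [Lc], [K] and [Lc * K] respectively. *)
set c := Lc * (1 + K); have cL : Lc <= c by rewrite ler_peMr ?ltW// ltrDl.
have cK : Lc * K <= c by rewrite ler_pM2l// lerDr.
have c0 : 0 <= c by apply: le_trans cL; exact: ltW.
apply: ge_ereal_sup => _ [f [hf f1] <-]; rewrite /bloch_norm /rhs.
set SA := ereal_sup (alpha u phi @` _); set SB := ereal_sup (beta u phi @` _).
have a0 a : (0 <= alpha u phi a)%E by rewrite mule_ge0 ?lee_fin ?cmod_ge0// A2norm_ge0.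
have b0 a : disk a -> (0 <= beta u phi a)%E.
  move=> da; rewrite mule_ge0 ?A2norm_ge0// lee_fin ltW// (lt_le_trans l0)// logterm_ge//.
  exact: sp.2.
have leA a : disk a -> (alpha u phi a <= SA)%E.
  by move=> da; apply: ereal_sup_ubound; exists a.
have leB a : disk a -> (beta u phi a <= SB)%E.
  by move=> da; apply: ereal_sup_ubound; exists a.
have SA0 : (0 <= SA)%E := le_trans (a0 0) (leA _ (disk0 R)).
have SB0 : (0 <= SB)%E := le_trans (b0 _ (disk0 R)) (leB _ (disk0 R)).
have t0 : 0 <= cmod (u 0) * logterm (phi 0).
  rewrite mulr_ge0 ?cmod_ge0// ltW// (lt_le_trans l0)// logterm_ge//.
  exact: sp.2 (disk0 R).
have distr (x y : \bar R) : (0 <= x)%E -> (0 <= y)%E ->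
    (c%:E * (x + y) = c%:E * x + c%:E * y)%E by exact: ge0_muleDr.
have t0' : (0 <= (cmod (u 0) * logterm (phi 0))%:E)%E by rewrite lee_fin.
rewrite -addeA (distr _ _ t0' (adde_ge0 SA0 SB0)).
apply: leeD.
  rewrite -EFinM lee_fin /wcomp cmodM.
  apply: (@le_trans _ _ (Lc * (cmod (u 0) * logterm (phi 0)))).
    rewrite mulrCA; apply: ler_wpM2l; first exact: cmod_ge0.
    by apply: growth_logterm => //; exact: sp.2 (disk0 R).
  exact: ler_wpM2r.
apply: ge_ereal_sup => _ [a da <-].
have db := sp.2 _ da; have p := sqr_cmod_lt1 da; have pb := sqr_cmod_lt1 db.
rewrite (cder_dd (cder_wcomp hu sp hf da)).
set P := 1 - cmod a ^+ 2 in p *; set Q := 1 - cmod (phi a) ^+ 2 in pb *.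
(* The two terms of the product rule: [Q * |f'(phi a)| <= 1] leaves the hyperbolic derivative of
   [phi] in the first, and the growth of [f] puts the logarithm into the second. *)
apply: (@le_trans _ _ ((cmod (u a) * (P * cmod (dd phi a) / Q))%:E +
    (Lc * (logterm (phi a) * (P * cmod (dd u a))))%:E)%E).
  rewrite -EFinD lee_fin.
  apply: (@le_trans _ _ (P * (cmod (u a * (dd f (phi a) * dd phi a)) +
      cmod (f (phi a) * dd u a)))).
    by rewrite ler_pM2l// cmodD.
  rewrite mulrDr; apply: lerD.
    have [_ fs] := bloch_normP (r := 1) f1.
    have := fs _ db; rewrite -/Q !cmodM => fd.
    rewrite [leRHS]mulrA ler_pdivlMr//.
    have E (v1 v2 v3 v4 v5 : R) :
      v1 * (v2 * (v3 * v4)) * v5 = v2 * (v1 * v4) * (v5 * v3) by ring.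
    rewrite E; apply: ler_piMr; last exact: fd.
    by apply: mulr_ge0 (cmod_ge0 _) (mulr_ge0 (ltW p) (cmod_ge0 _)).
  rewrite cmodM.
  rewrite mulrCA [leRHS]mulrA.
  apply: ler_wpM2r; first exact: mulr_ge0 (ltW p) (cmod_ge0 _).
  exact: growth_logterm hf f1 db.
rewrite (distr _ _ SA0 SB0); apply: leeD.
  apply: (le_trans (alpha_ge da)); apply: lee_pmul.
  - by rewrite lee_fin ltW.
  - exact: a0.
  - by rewrite lee_fin; apply: le_trans cK; rewrite ler_peMl// ltW.
  - exact: leA.
rewrite EFinM; apply: (le_trans (lee_wpmul2l _ (beta_ge da))); first by rewrite lee_fin ltW.
rewrite muleA -EFinM; apply: lee_pmul.
- by rewrite lee_fin mulr_ge0// ltW.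
- exact: b0.
- by rewrite lee_fin.
- exact: leB.
Qed.

End UpperBound.

(* ||u C_phi||_{B->B}  ~  |u(0)| log(2/(1-|phi(0)|^2)) + sup_a alpha + sup_a beta,
   with absolute constants c, C > 0 (independent of u and phi). *)
Theorem theorem2p8 (R : realType) :
  exists c Cc : R, 0 < c /\ 0 < Cc /\
    forall u phi : R[i] -> R[i], holo u -> selfmap phi ->
      (c%:E * rhs u phi <= opnorm u phi)%E /\
      (opnorm u phi <= Cc%:E * rhs u phi)%E.
Proof.
have [K1 K10 H1] := dd_le_A2norm R; have [K2 K20 H2] := A2norm_le_hlog R.
have [K3 K30 H3] := logterm_sigma R.
pose D := 6 + 3 * K2 + 14 * K2 * (1 + K3).
have D0 : 0 < D.
  have h : 0 <= 14 * K2 * (1 + K3).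
    by apply: mulr_ge0; [apply: mulr_ge0 => //; exact: ltW|exact: addr_ge0].
  by rewrite /D; lra.
have l0 := @ln2_gt0 R.
exists D^-1, ((1 + (ln 2)^-1) * (1 + K1)); split; first by rewrite invr_gt0.
split; first by rewrite mulr_gt0// addr_gt0// invr_gt0.
move=> u phi hu sp; split; last exact: opnorm_le.
rewrite lee_pdivrMl//.
(* The test function 0 excludes the value -oo; if the norm is +oo the inequality is trivial, so a
   real bound [M] may be assumed. *)
have M0 : (0 <= opnorm u phi)%E.
  have d0 (z : R[i]) : cder (fun=> 0 : R[i]) z 0 by exact: cder_cst.
  apply: le_trans (bloch_norm_ge0 (wcomp u phi (fun=> 0))) _.
  apply: ereal_sup_ubound; exists (fun=> 0); last reflexivity.
  split; first by apply: (@cder_holo _ _ (fun=> 0)) => z _; exact: d0.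
  have -> : 1%E = (0 + 1)%:E :> \bar R by rewrite add0r.
  by apply: bloch_norm_le => [|z dz]; rewrite ?(cder_dd (d0 z)) cmod0 ?mulr0.
case E : (opnorm u phi) M0 => [M| |] M0 //; last by rewrite gt0_muley ?leey// lte_fin.
have uM : (opnorm u phi <= M%:E)%E by rewrite E.
have -> : (D%:E * M%:E = (6 * M)%:E + (3 * K2 * M)%:E + (14 * K2 * (1 + K3) * M)%:E)%E.
  by rewrite -EFinM -!EFinD; congr EFin; rewrite /D; ring.
rewrite /rhs; apply: leeD; first apply: leeD.
- by rewrite lee_fin; exact: u0_bound.
- by apply: ge_ereal_sup => _ [a da <-]; exact: alpha_le.
- by apply: ge_ereal_sup => _ [a da <-]; exact: beta_le.
Qed.
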